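(* Suppose $r \geq 4$. Let $\widetilde{\mathcal{C}} \subset \mathbb{P}^{r+1}$ be the standard rational normal curve of degree $r+1$, let $p \in \mathbb{P}^{r+1}$ be a point with $\mathrm{rank}_{\widetilde{\mathcal{C}}}(p) = 3$, and let $\mathcal{C} = \pi_p(\widetilde{\mathcal{C}}) \subset \mathbb{P}^r$. Let $\mathbb{L}$ be the unique trisecant line of $\mathcal{C}$ and let $X = \mathcal{C} \cup \mathbb{L}$. Then: (1) $\mathrm{rank\text{-}index}(X) \leq 4$. (2) If $\mathcal{C} \cap \mathbb{L}$ has at most two points, or equivalently, if $\mathcal{C} \cap \mathbb{L}$ contains a point with multiplicity at least two, then $\mathrm{rank\text{-}index}(X) = 4$.
   Context: Work over an algebraically closed field $\mathbb{K}$ of characteristic $0$. The standard rational normal curve of degree $r+1$ is $\widetilde{\mathcal{C}} = \{[s^{r+1} : s^{r}t : \cdots : t^{r+1}] \mid [s:t]\in \mathbb{P}^1\} \subset \mathbb{P}^{r+1}$. For $k \ge 1$, $\widetilde{\mathcal{C}}^k$ denotes the $k$-th self-join of $\widetilde{\mathcal{C}}$, i.e. the closure of the set of points lying in $(k-1)$-dimensional linear subspaces spanned by general collections of $k$ points of $\widetilde{\mathcal{C}}$. For $p \in \mathbb{P}^{r+1}$ put $\mathrm{rank}_{\widetilde{\mathcal{C}}}(p) = \min\{k \mid p \in \widetilde{\mathcal{C}}^k\}$. $\pi_p : \mathbb{P}^{r+1} \dashrightarrow \mathbb{P}^r$ denotes the linear projection from $p$. When $\mathrm{rank}_{\widetilde{\mathcal{C}}}(p)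 = 3$ and $r\ge 4$, $\mathcal{C}$ is a smooth rational curve of degree $r+1$ which admits a unique trisecant line $\mathbb{L}$, i.e. a line whose scheme-theoretic intersection with $\mathcal{C}$ has length (at least) $3$; multiplicities of points of $\mathcal{C}\cap\mathbb{L}$ refer to this scheme-theoretic intersection. The homogeneous ideal of the reducible curve $X = \mathcal{C}\cup\mathbb{L}$ is generated by the quadratic polynomials in the homogeneous ideal of $\mathcal{C}$. A closed subscheme $X \subset \mathbb{P}^r$ satisfies property $\mathrm{QR}(k)$ if its (saturated) homogeneous ideal is generated by quadratic polynomials of rank at most $k$ (the rank of a quadratic form is the rank of its associated symmetric matrix). If the homogeneous ideal of $X$ is generated by quadrics, $\mathrm{rank\text{-}index}(X)$ is the least integer $k$ such that $X$ satisfies property $\mathrm{QR}(k)$. *)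

(* Defs.v *)
From HB Require Import structures.
From mathcomp Require Import all_boot all_order all_algebra.
From mathcomp Require Export mpoly.

Set Implicit Arguments.
Unset Strict Implicit.
Unset Printing Implicit Defensive.

Import GRing.Theory.
Local Open Scope ring_scope.

(* Points of P^(n-1) are represented by nonzero row vectors in 'rV[K]_n; two   *)
(* of them represent the same point when they span the same line, that is     *)
(* (u == v)%MS.  A subset of P^(n-1) is a predicate on row vectors that holds  *)
(* only at nonzero vectors and is stable under nonzero scaling.               *)

Section ProjectiveSets.
Variables (K : fieldType) (n : nat).
Implicit Types (A B : 'rV[K]_n -> Prop) (u v p q : 'rV[K]_n).
Implicit Types (f g h : {mpoly K[n]}) (I J G : {mpoly K[n]} -> Prop).

Definition mevalv f v : K := f.@[fun i => v 0 i].

Definition is_form f : Prop := exists d : nat, f \is d.-homog.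

Definition vanishes_on A f : Prop := forall v, A v -> mevalv f v = 0.

Definition zclosure A v : Prop :=
  v != 0 /\ forall f, is_form f -> vanishes_on A f -> mevalv f v = 0.

Definition ideal_gen G f : Prop :=
  exists s : seq ({mpoly K[n]} * {mpoly K[n]}),
    (forall x, x \in s -> G x.2) /\ f = \sum_(x <- s) x.1 * x.2.

Definition hideal A : {mpoly K[n]} -> Prop :=
  ideal_gen (fun f => is_form f /\ vanishes_on A f).

Definition ideal_sum I J f : Prop := exists g h, [/\ I g, J h & f = g + h].

Definition pts_union A B v : Prop := A v \/ B v.

Definition pts_inter A B v : Prop := A v /\ B v.

Definition at_most_two_points A : Prop :=
  forall u v w, A u -> A v -> A w ->
    [|| (u == v)%MS, (u == w)%MS | (v == w)%MS].

Definition pts_line (L : 'M[K]_(2, n)) v : Prop := v != 0 /\ (v <= L)%MS.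

(* Row independence of P is the genericity required of the k points: it says  *)
(* exactly that their linear span has projective dimension k - 1.             *)
Definition secant_pts A (k : nat) v : Prop :=
  v != 0 /\ exists P : 'M[K]_(k, n),
    [/\ forall i, A (row i P), row_free P & (v <= P)%MS].

Definition self_join A (k : nat) : 'rV[K]_n -> Prop :=
  zclosure (secant_pts A k).

Definition has_rank A p (k : nat) : Prop :=
  [/\ (0 < k)%N, self_join A k p
    & forall j : nat, (0 < j)%N -> self_join A j p -> (k <= j)%N].

(* Linear independence of a finite family in the quotient by the subspace J.  *)
Definition indep_mod J (m : nat) (f : 'I_m -> {mpoly K[n]}) : Prop :=
  forall c : 'I_m -> K, J (\sum_i c i *: f i) -> forall i, c i = 0.

(* The value of the Hilbert polynomial of K[x]/J, i.e. the length of the      *)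
(* closed subscheme of P^(n-1) defined by J when it is finite, is at least m. *)
Definition length_ge J (m : nat) : Prop :=
  exists d0 : nat, forall d : nat, (d0 <= d)%N ->
    exists f : 'I_m -> {mpoly K[n]},
      (forall i, f i \is d.-homog) /\ indep_mod J f.

(* For a form f, this says that the germ f / g (with g a form of the same     *)
(* degree not vanishing at q) lies in the localized ideal J_q of O_(P,q).     *)
Definition local_ideal J q f : Prop :=
  exists h, [/\ is_form h, mevalv h q != 0 & J (h * f)].

(* dim_K (O_(P,q) / J_q) >= m.  Finitely many germs have a common             *)
(* denominator, which is a unit, so independence is tested on numerators.     *)
Definition mult_ge J q (m : nat) : Prop :=
  exists (d : nat) (f : 'I_m -> {mpoly K[n]}),
    (forall i, f i \is d.-homog) /\ indep_mod (local_ideal J q) f.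

(* The ideal defining the scheme-theoretic intersection of A (a closed set    *)
(* with its reduced structure) with the line L.                               *)
Definition inter_ideal A (L : 'M[K]_(2, n)) : {mpoly K[n]} -> Prop :=
  ideal_sum (hideal A) (hideal (pts_line L)).

Definition trisecant_line A (L : 'M[K]_(2, n)) : Prop :=
  row_free L /\ length_ge (inter_ideal A L) 3.

Definition sym_mx_of f : 'M[K]_n :=
  \matrix_(i, j) (f@_(U_(i) + U_(j)) / (if i == j then 1 else 2)).

Definition quad_rank f : nat := \rank (sym_mx_of f).

Definition QR (k : nat) I : Prop :=
  exists G : {mpoly K[n]} -> Prop,
    (forall g, G g -> g \is 2.-homog /\ (quad_rank g <= k)%N) /\
    (forall f, I f <-> ideal_gen G f).

Definition is_rank_index I (k : nat) : Prop :=
  QR k I /\ forall j : nat, QR j I -> (k <= j)%N.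

End ProjectiveSets.

Section RationalNormalCurve.
Variable K : fieldType.

Definition rnc_vec (n : nat) (s t : K) : 'rV[K]_n.+1 :=
  \row_(i < n.+1) (s ^+ (n - i) * t ^+ i).

Definition rnc (n : nat) (v : 'rV[K]_n.+1) : Prop :=
  exists s t : K, ((s != 0) || (t != 0)) /\ (v == rnc_vec n s t)%MS.

(* M is the matrix, acting on row vectors, of a linear projection from p; it  *)
(* is determined by p up to a linear change of coordinates on the target.     *)
Definition projection_from (n : nat) (p : 'rV[K]_n.+1) (M : 'M[K]_(n.+1, n)) :
  Prop := row_full M /\ (kermx M == p)%MS.

Definition proj_image (m n : nat) (M : 'M[K]_(m, n)) (A : 'rV[K]_m -> Prop)
  (w : 'rV[K]_n) : Prop := w != 0 /\ exists v, A v /\ w = v *m M.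

End RationalNormalCurve.

(* Main.v *)
Require Import Defs.
From HB Require Import structures.
From mathcomp Require Import all_boot all_order all_algebra.
From mathcomp Require Import mpoly ring zify.
From Stdlib Require Import Classical.

Set Implicit Arguments.
Unset Strict Implicit.
Unset Printing Implicit Defensive.

Import GRing.Theory.
Local Open Scope ring_scope.

(* Dehomogenize: let S_k be the polynomials of degree at most k and n = r + 1.  The
   coordinates on P^r pull back to a basis of the hyperplane V of S_n orthogonal to p.
   Since p lies on no secant or tangent line, no quadratic q satisfies q S_(n-2) <= V;
   hence V V = S_(2n), and a line L meeting C in length 3 is cut out by g S_(n-3) <= V for
   a cubic g whose roots are the points of C on L.  After a Moebius change of parameter g
   has no root at infinity.

   Let E be a polynomial of degree at most 2 with E and E X in V; it is prime to g and
   V = <E, E X> + g S_(n-3).  So C and L lie on the rational normal scroll with blocks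
   (E, E X) and (g, g X, ..., g X^(n-3)).  Modulo the 2 x 2 minors of the scroll a form of
   degree d is a sum of terms N_k(f_k), k <= d, which restrict to E^(d-k) g^k f_k on C.  If
   the form vanishes on C and L then f_0 = 0, and f_1, f_2, ... are eliminated in turn
   since g divides E^(d-k) f_k.  With y_0, y_1, u_h the linear forms pulling back to E, E X
   and g h, the relation used is given by the quadrics (y_1 - z y_0) u_(q f) - u_1 u_(E f),
   where g = (X - z) q.  These and the minors have rank at most 4.

   If g has a root z of order a >= 2, let v_i be the Taylor coefficients of the
   parametrization at z.  The Gram matrix of (v_0, v_1, v_a, v_(a+1)) for a quadric Q
   through C and L is antitriangular with antidiagonal (c, -c, -c, c), c = Q(v_0, v_(a+1)).
   So c = 0 if Q has rank at most 3, while c <> 0 for one minor of the scroll. *)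

(** * Forms, ideals and quadrics *)

Section Forms.
Variables (K : fieldType) (n : nat).
Implicit Types (v : 'I_n -> {poly K}) (F G : {mpoly K[n]}) (I J : {mpoly K[n]} -> Prop)
  (c : 'rV[K]_n).

Lemma mdegS (m : 'X_{1..n}) d : mdeg m = d.+1 ->
  exists j m', m = (U_(j) + m')%MM /\ mdeg m' = d.
Proof.
move=> hm; have [j hj] : exists j, m j != 0%N.
  apply/existsP; rewrite -negb_forall; apply/forallP => m0.
  by move: hm; rewrite mdegE big1 // => i _; apply/eqP.
have le_jm : (U_(j) <= m)%MM.
  by apply/mnm_lepP => i; rewrite mnm1E; case: eqP => // <-; rewrite lt0n.
exists j, (m - U_(j))%MM; rewrite addmC submK //; split=> //.
by move: hm; rewrite -{1}(submK le_jm) mdegD mdeg1 addn1 => -[].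
Qed.

(** A form is a combination of monomials, and a monomial arises by multiplying by one variable at a
    time. The degree is an argument of [P] so that bounds depending on it can be carried along. *)
Lemma dhomog_ind (P : nat -> {mpoly K[n]} -> Prop) :
    P 0%N 1 -> (forall d, P d 0) ->
    (forall d F G, P d F -> P d G -> P d (F + G)) ->
    (forall d a F, P d F -> P d (a *: F)) ->
    (forall d j F, P d F -> P d.+1 ('X_j * F)) ->
  forall d F, F \is d.-homog -> P d F.
Proof.
move=> P1 P0 PD PZ PX d F /dhomogP hF.
have Pmon e (m : 'X_{1..n}) : mdeg m = e -> P e 'X_[m].
  elim: e m => [|e IHe] m.
    by move/eqP; rewrite mdeg_eq0 => /eqP ->; rewrite mpolyX0.
  by case/mdegS => j [m' [-> /IHe Pm']]; rewrite mpolyXD; apply: PX.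
rewrite [F]mpolyE big_seq.
by elim/big_ind: _ => [|G H|m hm] //; [exact: PD | apply/PZ/Pmon/hF].
Qed.

Definition lin c : {mpoly K[n]} := \sum_j c 0 j *: 'X_j.

Lemma lin_homog c : lin c \is 1.-homog.
Proof.
apply: rpred_sum => j _; apply: rpredZ.
by rewrite dhomogX /= mdeg1.
Qed.

Lemma lin_is_linear : linear lin.
Proof.
move=> a c c'; rewrite /lin scaler_sumr -big_split /=.
by apply: eq_bigr => j _; rewrite !mxE scalerDl scalerA.
Qed.
HB.instance Definition _ := GRing.isLinear.Build K _ _ _ lin lin_is_linear.

Lemma lin_delta j : lin (delta_mx 0 j) = 'X_j.
Proof.
rewrite /lin (bigD1 j) //= big1 => [|i ij]; rewrite mxE eqxx ?eqxx ?scale1r ?addr0 //.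
by rewrite (negPf ij) scale0r.
Qed.

Lemma meval_lin (x : 'I_n -> K) c : (lin c).@[x] = \sum_j c 0 j * x j.
Proof.
rewrite /lin raddf_sum; apply: eq_bigr => j _.
by rewrite /= mevalZ mevalXU.
Qed.

Lemma mevalv_lin (x : 'rV[K]_n) c : mevalv (lin c) x = (x *m c^T) 0 0.
Proof.
rewrite /mevalv meval_lin mxE; apply: eq_bigr => j _.
by rewrite mxE mulrC.
Qed.

Lemma mevalvM F G x : mevalv (F * G) x = mevalv F x * mevalv G x.
Proof. exact: mevalM. Qed.

Lemma mevalv_sum (T : Type) (s : seq T) (P : pred T) (F : T -> {mpoly K[n]}) x :
  mevalv (\sum_(i <- s | P i) F i) x = \sum_(i <- s | P i) mevalv (F i) x.
Proof.
apply: (big_morph (fun G => mevalv G x)); last exact: meval0.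
by move=> G H; exact: mevalD.
Qed.

Lemma meval_homogZ d F (x : 'I_n -> K) a :
  F \is d.-homog -> F.@[fun j => a * x j] = a ^+ d * F.@[x].
Proof.
move: d F; apply: dhomog_ind => [|d|d F G IHF IHG|d b F IHF|d j F IHF].
- by rewrite !meval1 mulr1.
- by rewrite !meval0 mulr0.
- by rewrite !mevalD IHF IHG mulrDr.
- by rewrite !mevalZ IHF mulrCA.
- by rewrite !mevalM !mevalXU IHF exprS; ring.
Qed.

Lemma mevalvZ d F x a : F \is d.-homog -> mevalv F (a *: x) = a ^+ d * mevalv F x.
Proof.
move=> hF; rewrite /mevalv -(meval_homogZ _ _ hF).
by apply: meval_eq => j; rewrite mxE.
Qed.

(** Pullback of forms along the dehomogenized parametrization [v], cloned as a ring morphism so that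
    the [rmorph] lemmas apply. *)
Definition pmeval (v : 'I_n -> {poly K}) : {rmorphism {mpoly K[n]} -> {poly K}} :=
  GRing.RMorphism.clone _ _ (mmap (@polyC K) v) _.

Lemma pmevalX v j : pmeval v 'X_j = v j.
Proof. by rewrite /pmeval /= mmapX mmap1U. Qed.

Lemma pmevalZ v a F : pmeval v (a *: F) = a *: pmeval v F.
Proof. by rewrite /pmeval /= mmapZ mul_polyC. Qed.

Lemma pmeval_lin v c : pmeval v (lin c) = \sum_j c 0 j *: v j.
Proof.
rewrite /lin rmorph_sum; apply: eq_bigr => j _.
by rewrite /= pmevalZ pmevalX.
Qed.

Lemma mpoly_eq_rmorph (S : comPzRingType) (f g : {rmorphism {mpoly K[n]} -> S}) F :
  (forall a, f a%:MP = g a%:MP) -> (forall j, f 'X_j = g 'X_j) -> f F = g F.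
Proof.
move=> fgC fgX; rewrite [F]mpolyE !rmorph_sum; apply: eq_bigr => m _ /=.
rewrite -mul_mpolyC !rmorphM fgC; congr (_ * _).
rewrite mpolyXE_id !rmorph_prod; apply: eq_bigr => i _ /=.
by rewrite !rmorphXn fgX.
Qed.

Lemma horner_pmeval v F x : (pmeval v F).[x] = F.@[fun j => (v j).[x]].
Proof.
rewrite -[LHS]/((horner_eval x \o pmeval v) F) -[RHS]/((meval _) F).
apply: mpoly_eq_rmorph => [a|j] /=.
  by rewrite /pmeval /= mmapC mevalC /horner_eval hornerC.
by rewrite pmevalX mevalXU.
Qed.

Lemma size_pmeval v e d F : (forall j, (size (v j) <= e.+1)%N) ->
  F \is d.-homog -> (size (pmeval v F) <= (e * d).+1)%N.
Proof.
move=> sv; move: d F; apply: dhomog_ind => [|d|d F G IHF IHG|d b F IHF|d j F IHF].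
- by rewrite rmorph1 size_poly1.
- by rewrite raddf0 size_poly0.
- by rewrite raddfD (leq_trans (size_polyD _ _)) // geq_max IHF IHG.
- by rewrite pmevalZ (leq_trans (size_scale_leq _ _)).
- rewrite rmorphM /= pmevalX (leq_trans (size_polyMleq _ _)) //.
  have := leq_add (sv j) IHF; move: (size (v j) + _)%N => k.
  by rewrite mulnS; lia.
Qed.

(** * Generated ideals *)

Lemma ideal_gen_mem (P : {mpoly K[n]} -> Prop) F : P F -> ideal_gen P F.
Proof.
move=> PF; exists [:: (1, F)]; split; last by rewrite big_seq1 mul1r.
by move=> x; rewrite inE => /eqP ->.
Qed.

Lemma ideal_gen0 (P : {mpoly K[n]} -> Prop) : ideal_gen P 0.
Proof. by exists [::]; rewrite big_nil. Qed.

Lemma ideal_genD (P : {mpoly K[n]} -> Prop) F G :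
  ideal_gen P F -> ideal_gen P G -> ideal_gen P (F + G).
Proof.
move=> [s [Ps ->]] [t [Pt ->]]; exists (s ++ t); rewrite big_cat; split=> // x.
by rewrite mem_cat => /orP [/Ps|/Pt].
Qed.

Lemma ideal_genM (P : {mpoly K[n]} -> Prop) H F :
  ideal_gen P F -> ideal_gen P (H * F).
Proof.
move=> [s [Ps ->]]; exists [seq (H * x.1, x.2) | x <- s]; split.
  by move=> x /mapP [y /Ps Py ->].
by rewrite big_map mulr_sumr; apply: eq_bigr => x _; rewrite mulrA.
Qed.

Lemma ideal_genZ (P : {mpoly K[n]} -> Prop) a F :
  ideal_gen P F -> ideal_gen P (a *: F).
Proof. by rewrite -mul_mpolyC; exact: ideal_genM. Qed.

Lemma ideal_genN (P : {mpoly K[n]} -> Prop) F :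
  ideal_gen P F -> ideal_gen P (- F).
Proof. by rewrite -scaleN1r; exact: ideal_genZ. Qed.

Lemma ideal_gen_sum (P : {mpoly K[n]} -> Prop) (T : Type) (s : seq T) (Q : pred T)
    (f : T -> {mpoly K[n]}) :
  (forall i, Q i -> ideal_gen P (f i)) -> ideal_gen P (\sum_(i <- s | Q i) f i).
Proof.
move=> Pf; elim/big_ind: _ => //; [exact: ideal_gen0 | exact: ideal_genD].
Qed.

Lemma ideal_gen_ker (P : {mpoly K[n]} -> Prop) (S : pzRingType)
    (f : {rmorphism {mpoly K[n]} -> S}) F :
  (forall G, P G -> f G = 0) -> ideal_gen P F -> f F = 0.
Proof.
move=> Pf [s [Ps ->]]; rewrite rmorph_sum big_seq big1 // => x xs.
by rewrite /= rmorphM /= (Pf x.2) ?mulr0 //; apply: Ps.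
Qed.

Lemma ideal_gen_sub (P Q : {mpoly K[n]} -> Prop) F :
  (forall G, P G -> ideal_gen Q G) -> ideal_gen P F -> ideal_gen Q F.
Proof.
move=> PQ [s [Ps ->]]; rewrite big_seq; apply: ideal_gen_sum => x xs.
by apply/ideal_genM/PQ/Ps.
Qed.

(** * Symmetric matrices of quadratic forms *)

Lemma sym_mx_is_linear : linear (@sym_mx_of K n).
Proof.
move=> a F G; apply/matrixP => i j; rewrite !mxE mcoeffD mcoeffZ.
by rewrite mulrDl mulrA.
Qed.
HB.instance Definition _ :=
  GRing.isLinear.Build K _ _ _ (@sym_mx_of K n) sym_mx_is_linear.

Hypothesis K2 : (2%:R : K) != 0.

Lemma mnm2_eq (i j k l : 'I_n) :
  (U_(i) + U_(j) == U_(k) + U_(l))%MM =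
  ((i == k) && (j == l)) || ((i == l) && (j == k)).
Proof.
apply/eqP/orP => [|[|] /andP [/eqP -> /eqP ->]] //; last exact: addmC.
move=> e; case: (eqVneq i k) e => [-> /addmI /eqP|ik e].
  by rewrite eq_mnm1 => jl; left.
have il : i = l.
  move/mnmP: e => /(_ i); rewrite !mnmDE !mnm1E eqxx [k == i]eq_sym (negPf ik).
  by case: (eqVneq l i) => // _; case: (j == i).
right; rewrite il eqxx; move: e; rewrite il addmC => /addIm /eqP.
by rewrite eq_mnm1.
Qed.

(** One formula serves both cases: for a square the two indicators coincide and their sum cancels
    the 2. *)
Lemma sym_mx_XX (k l i j : 'I_n) :
  sym_mx_of ('X_k * 'X_l : {mpoly K[n]}) i j =
  (((i == k) && (j == l))%:R + ((i == l) && (j == k))%:R) / 2%:R.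
Proof.
rewrite mxE -mpolyXD mcoeffX mnm2_eq [k == i]eq_sym [l == j]eq_sym.
rewrite [k == j]eq_sym [l == i]eq_sym [(j == k) && _]andbC.
case: (eqVneq i j) => [<-|ij]; last first.
  by congr (_ / _); case: (eqVneq i k) => [<-|_]; case: (eqVneq i l) => [<-|_];
     rewrite ?[j == i]eq_sym ?(negPf ij) ?andbF ?orbF ?addr0 ?add0r //=;
       case: (j == _); rewrite ?addr0.
by case: (i == k); case: (i == l);
  rewrite /= ?addr0 ?mul0r ?divr1 // -[1 + 1]/(2%:R) divff.
Qed.

Lemma sym_mx_linM (a b : 'rV[K]_n) :
  sym_mx_of (lin a * lin b) = 2%:R^-1 *: (a^T *m b + b^T *m a).
Proof.
have -> : lin a * lin b = \sum_k \sum_l (a 0 k * b 0 l) *: ('X_k * 'X_l).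
  rewrite /lin mulr_suml; apply: eq_bigr => k _; rewrite mulr_sumr.
  by apply: eq_bigr => l _; rewrite -scalerAl -scalerAr scalerA.
have delta (x : 'I_n) (f : 'I_n -> K) : \sum_k f k * (x == k)%:R = f x.
  rewrite (bigD1 x) //= big1 ?addr0 ?eqxx ?mulr1 // => k.
  by rewrite eq_sym => /negPf ->; rewrite mulr0.
apply/matrixP => i j; rewrite linear_sum summxE.
transitivity (\sum_k \sum_l (a 0 k * (i == k)%:R * (b 0 l * (j == l)%:R) +
    a 0 k * (j == k)%:R * (b 0 l * (i == l)%:R)) / 2%:R).
  apply: eq_bigr => k _; rewrite linear_sum summxE; apply: eq_bigr => l _.
  rewrite linearZ mxE sym_mx_XX -!mulnb !natrM; ring.
under eq_bigr do rewrite -mulr_suml big_split /= -!mulr_sumr !delta.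
rewrite -mulr_suml big_split /= -!mulr_suml !delta !mxE !big_ord1 !mxE.
by ring.
Qed.

(** A product of two linear forms has as matrix a sum of two matrices of rank at most 1. *)
Lemma quad_rank_le4 (a b c d : 'rV[K]_n) e :
  (quad_rank (lin a * lin b + e *: (lin c * lin d)) <= 4)%N.
Proof.
rewrite /quad_rank linearD linearZ /= !sym_mx_linM scalerA scalerDr scalerDr.
have r1 x (u w : 'rV[K]_n) : (\rank (x *: (u^T *m w)) <= 1)%N.
  by rewrite (leq_trans (mxrank_scale _ _)) // (leq_trans (mxrankM_maxr _ _)) //
    rank_leq_row.
do !(apply: leq_trans (mxrank_add _ _) _).
have := leq_add (leq_add (r1 2%:R^-1 a b) (r1 2%:R^-1 b a)) (leq_add (r1 (e * 2%:R^-1)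
  c d) (r1 (e * 2%:R^-1) d c)).
by apply: leq_trans; apply: leq_add; apply: mxrank_add.
Qed.

Lemma quadric_sym_mx F : F \is 2.-homog ->
  F = \sum_i \sum_j sym_mx_of F i j *: ('X_i * 'X_j).
Proof.
pose S F := \sum_i \sum_j sym_mx_of F i j *: ('X_i * 'X_j) : {mpoly K[n]}.
have SD : linear S.
  move=> a G H; rewrite /S scaler_sumr -big_split; apply: eq_bigr => i _ /=.
  rewrite scaler_sumr -big_split; apply: eq_bigr => j _ /=.
  by rewrite linearP !mxE scalerDl scalerA.
(* Packing [S] as a linear map reduces the identity to the monomials ['X_k * 'X_l]. *)
pose Sl := GRing.isLinear.Build K _ _ _ S SD.
pose T : {linear {mpoly K[n]} -> {mpoly K[n]}} := HB.pack S Sl.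
have TX (k l : 'I_n) : T ('X_k * 'X_l) = 'X_k * 'X_l.
  have delta (x : 'I_n) (f : 'I_n -> {mpoly K[n]}) : \sum_k (k == x)%:R *: f k = f x.
    rewrite (bigD1 x) //= big1 ?addr0 ?eqxx ?scale1r // => m.
    by move=> /negPf ->; rewrite scale0r.
  have e (i j : 'I_n) : sym_mx_of ('X_k * 'X_l : {mpoly K[n]}) i j *: ('X_i * 'X_j)
    = (i == k)%:R *: ((j == l)%:R *: (2%:R^-1 *: ('X_i * 'X_j))) +
      (i == l)%:R *: ((j == k)%:R *: (2%:R^-1 *: ('X_i * 'X_j))) :> {mpoly K[n]}.
    rewrite sym_mx_XX -!mulnb !natrM !scalerA -scalerDl; congr (_ *: _); ring.
  rewrite /= /S; under eq_bigr => i _.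
    under eq_bigr do rewrite e.
    rewrite big_split /= -!scaler_sumr !delta.
    over.
  rewrite big_split /= !delta ['X_l * _]mulrC -scalerDl.
  have -> : 2%:R^-1 + 2%:R^-1 = 1 :> K by field.
  by rewrite scale1r.
move=> /dhomogP hF; rewrite -[RHS]/(T F) [in RHS](mpolyE F) linear_sum.
rewrite [LHS]mpolyE big_seq [RHS]big_seq; apply: eq_bigr => m /hF hm.
have [k [m' [-> /mdegS [l [m'' [-> /eqP]]]]]] := mdegS hm.
by rewrite mdeg_eq0 => /eqP ->; rewrite addm0 mpolyXD linearZ TX.
Qed.

Lemma sym_mx_of_tr F : (sym_mx_of F)^T = sym_mx_of F.
Proof. by apply/matrixP => i j; rewrite !mxE addmC eq_sym. Qed.

Lemma pmeval_quadric v F : F \is 2.-homog ->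
  pmeval v F = \sum_i \sum_j sym_mx_of F i j *: (v i * v j).
Proof.
move=> /quadric_sym_mx {1}->; rewrite rmorph_sum; apply: eq_bigr => i _ /=.
rewrite rmorph_sum; apply: eq_bigr => j _ /=.
by rewrite pmevalZ rmorphM /= !pmevalX.
Qed.

Lemma mevalv_quadric F (x : 'rV[K]_n) : F \is 2.-homog ->
  mevalv F x = (x *m sym_mx_of F *m x^T) 0 0.
Proof.
move=> /quadric_sym_mx {1}->; rewrite -mulmxA mxE /mevalv raddf_sum.
apply: eq_bigr => i _ /=; rewrite raddf_sum mxE mulr_sumr.
apply: eq_bigr => j _ /=; rewrite mevalZ mevalM !mevalXU !mxE; ring.
Qed.

(** [sym_mx_of] reads coefficients of degree 2 only, and those of H G come from the constant term of
    H. Thus membership of a quadric in an ideal generated by quadrics becomes a linear relation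
    between matrices. *)
Lemma sym_mx_ofM H G : G \is 2.-homog ->
  sym_mx_of (H * G) = H@_0%MM *: sym_mx_of G.
Proof.
move=> hG; apply/matrixP => i j; rewrite !mxE mulrA; congr (_ / _).
rewrite [in LHS](mpolyE H) [in RHS](mpolyE H) mulr_suml !raddf_sum mulr_suml.
apply: eq_bigr => m _ /=; rewrite -scalerAl !mcoeffZ mcoeffX.
case: eqP => [->|/eqP m0]; first by rewrite mpolyX0 mul1r mulr1.
have hXG : 'X_[m] * G \is (mdeg m + 2).-homog by apply: dhomogM => //; rewrite dhomogX.
rewrite (dhomog_nemf_coeff hXG) ?mulr0 ?mul0r //.
by rewrite /= mdegD !mdeg1 -{1}[(1 + 1)%N]add0n eqn_add2r eq_sym mdeg_eq0.
Qed.

End Forms.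

Lemma poly_lin_ind (K : fieldType) (P : {poly K} -> Prop) d :
    P 0 -> (forall f g, P f -> P g -> P (f + g)) ->
    (forall a f, P f -> P (a *: f)) -> (forall w, (w <= d)%N -> P 'X^w) ->
  forall f : {poly K}, (size f <= d.+1)%N -> P f.
Proof.
move=> P0 PD PZ PX f sf.
rewrite -(coefK f) poly_def; elim/big_ind: _ => // i _; apply/PZ/PX.
by have := ltn_ord i; lia.
Qed.

Lemma dvdp_sum (K : fieldType) (T : Type) (s : seq T) (P : pred T) (f : T -> {poly K})
  h :
  (forall i, P i -> h %| f i) -> h %| \sum_(i <- s | P i) f i.
Proof.
move=> hf; elim/big_rec: _ => [|i x Pi hx]; first exact: dvdp0.
by rewrite dvdp_add ?hf.
Qed.

(** * Straightening on a rational normal scroll *)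

(** Otherwise f times the product of the X - y, y in [s], would be nonzero and have a nonroot. The
    list [s] leaves room for exceptional parameters. *)
Lemma poly_root_eq0 (K : closedFieldType) (f : {poly K}) (s : seq K) :
  (forall x, x \notin s -> f.[x] = 0) -> f = 0.
Proof.
move=> f0; apply/eqP; apply: contraT => nf.
have nb : f * \prod_(y <- s) ('X - y%:P) != 0.
  rewrite mulf_neq0 // prodf_seq_neq0; apply/allP => y _.
  by rewrite polyXsubC_eq0.
have [x] := closed_nonrootP _ nb; rewrite rootE hornerM mulf_eq0 negb_or => /andP [fx].
rewrite -rootE root_prod_XsubC => /f0 fx0.
by rewrite fx0 eqxx in fx.
Qed.

Section Scroll.
Variables (K : closedFieldType) (K2 : (2%:R : K) != 0) (n m : nat) (hm : (2 <= m)%N).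
Variables (v : 'I_n -> {poly K}) (xi : {linear {poly K} -> 'rV[K]_n}).
Variables (E g q : {poly K}) (z : K).
Hypotheses (size_E : (size E <= 3)%N) (size_g : size g = 4%N).
Hypotheses (g_fact : g = ('X - z%:P) * q) (coprime_gE : coprimep g E).

Implicit Types (f h : {poly K}) (F G H : {mpoly K[n]}) (cs : seq bool).

(* The blocks of the scroll: false stands for (E, E X), true for (g, g X, ..., g X^m). *)
Definition base (c : bool) := if c then g else E.
Definition cap (c : bool) := if c then m else 1%N.
(** The linear form pulling back to [base c * h]: [zeta false 1] and [zeta false 'X] are y_0 and
    y_1, [zeta true h] is u_h. *)
Definition zeta c (h : {poly K}) : {mpoly K[n]} := lin (xi (base c * h)).

Hypothesis xiK : forall c (h : {poly K}), (size h <= (cap c).+1)%N ->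
  \sum_j xi (base c * h) 0 j *: v j = base c * h.
Hypothesis var_dec : forall j : 'I_n, exists h h' : {poly K},
  [/\ (size h <= 2)%N, (size h' <= m.+1)%N & 'X_j = zeta false h + zeta true h'].

(** The cone over L, zero vector included. *)
Definition on_line (x : 'rV[K]_n) :=
  forall h : {poly K}, (size h <= m.+1)%N -> mevalv (zeta true h) x = 0.
Hypothesis line_pt : forall t, exists x, 
  [/\ on_line x, mevalv (zeta false 1) x = 1 & mevalv (zeta false 'X) x = t].

Definition quadrics4 (F : {mpoly K[n]}) :=
  [/\ F \is 2.-homog, (quad_rank F <= 4)%N, pmeval v F = 0 &
      forall x, on_line x -> mevalv F x = 0].

Definition eqv F G := ideal_gen quadrics4 (F - G).

Lemma eqv_refl F : eqv F F.
Proof. by rewrite /eqv subrr; exact: ideal_gen0. Qed.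
Lemma eqv_sym F G : eqv F G -> eqv G F.
Proof. by move=> /ideal_genN; rewrite opprB. Qed.
Lemma eqv_trans F G H : eqv F G -> eqv G H -> eqv F H.
Proof. by move=> FG /(ideal_genD FG); rewrite addrA subrK. Qed.
Lemma eqvD F G F' G' : eqv F G -> eqv F' G' -> eqv (F + F') (G + G').
Proof. by move=> FG /(ideal_genD FG); rewrite /eqv; congr ideal_gen; ring. Qed.
Lemma eqvM H F G : eqv F G -> eqv (H * F) (H * G).
Proof. by move=> /(ideal_genM H); rewrite mulrBr. Qed.
Lemma eqvZ a F G : eqv F G -> eqv (a *: F) (a *: G).
Proof. by move=> /(ideal_genZ a); rewrite scalerBr. Qed.
Lemma eqv_sum (T : Type) (s : seq T) (P : pred T) (F G : T -> {mpoly K[n]}) :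
  (forall i, P i -> eqv (F i) (G i)) ->
  eqv (\sum_(i <- s | P i) F i) (\sum_(i <- s | P i) G i).
Proof. by move=> FG; rewrite /eqv -sumrB; apply: ideal_gen_sum. Qed.

Lemma zeta_is_linear c : linear (zeta c).
Proof. by move=> a h h'; rewrite /zeta mulrDr -scalerAr !linearP. Qed.
HB.instance Definition _ c := GRing.isLinear.Build K _ _ _ (zeta c) (zeta_is_linear c).

Lemma pmeval_zeta c h : (size h <= (cap c).+1)%N -> pmeval v (zeta c h) = base c * h.
Proof. by move=> sh; rewrite /zeta pmeval_lin xiK. Qed.

Lemma quadrics4I a b c d e (F := lin a * lin b + e *: (lin c * lin d)) :
  pmeval v F = 0 -> (forall x, on_line x -> mevalv F x = 0) -> quadrics4 F.
Proof.
move=> F0 FL; split=> //; last exact: quad_rank_le4.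
by rewrite rpredD ?rpredZ // -[2%N]/(1 + 1)%N dhomogM ?lin_homog.
Qed.

(** These are the 2 x 2 minors of the scroll. On L each product has a factor u_h, unless both blocks
    are (E, E X); then i = j = 0 and the minor is zero by commutativity. *)
Lemma straighten c c' i j : (i < cap c)%N -> (j < cap c')%N ->
  eqv (zeta c 'X^i * zeta c' 'X^(j.+1)) (zeta c 'X^(i.+1) * zeta c' 'X^j).
Proof.
move=> hi hj; apply: ideal_gen_mem; rewrite -scaleN1r; apply: quadrics4I => [|x Lx].
  rewrite scaleN1r rmorphB !rmorphM /= -!/(zeta _ _).
  by rewrite !pmeval_zeta ?size_polyXn //; rewrite ?exprS; ring || lia.
rewrite scaleN1r /mevalv mevalB -!/(mevalv _ x) -!/(zeta _ _) !mevalvM.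
have L0 k : (k <= m)%N -> mevalv (zeta true 'X^k) x = 0.
  by move=> km; apply: Lx; rewrite size_polyXn.
case: c hi => hi; first by rewrite !L0 ?mul0r ?subrr // ltnW.
case: c' hj => hj; first by rewrite !L0 ?mulr0 ?subrr // ltnW.
by move: hi hj; rewrite !ltnS !leqn0 => /eqP -> /eqP ->; rewrite mulrC subrr.
Qed.

(* The monomials with blocks cs and weight w are all congruent modulo the minors; this
   one gives the first factors as much weight as possible (junk if w > capsum cs). *)
Fixpoint fill cs w : {mpoly K[n]} :=
  if cs is c :: cs' then zeta c 'X^(minn w (cap c)) * fill cs' (w - minn w (cap c))%N
  else 1.

Definition capsum cs := sumn (map cap cs).

(** [fill] loads the first factors first, so the weights w and w + 1 differ in one factor only,
    after factors that are full. [straighten] exchanges a unit of weight with that factor. *)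
Lemma transfer cs c i w : (i < cap c)%N -> (w < capsum cs)%N ->
  eqv (zeta c 'X^i * fill cs w.+1) (zeta c 'X^(i.+1) * fill cs w).
Proof.
move=> hi; elim: cs w => [|c' cs IHcs] w //= hw.
have [wc|cw] := leqP w.+1 (cap c').
  rewrite (minn_idPl _) ?(ltnW wc) // subnn subnn !mulrA ![_ * fill _ _]mulrC.
  exact/eqvM/straighten.
rewrite (minn_idPr _) ?(ltnW cw) // mulrCA [X in eqv _ X]mulrCA subSn //.
by apply/eqvM/IHcs; rewrite /capsum /= in hw *; lia.
Qed.

(** Units of weight move from the tail to the new factor until it is full or the tail has weight 0;
    either way the greedy monomial is reached. *)
Lemma fill_cons cs c i w : (i <= cap c)%N -> (w <= capsum cs)%N ->
  eqv (zeta c 'X^i * fill cs w) (fill (c :: cs) (i + w)).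
Proof.
elim: w i => [|w IHw] i hi hw /=.
  by rewrite addn0 (minn_idPl _) // subnn; exact: eqv_refl.
have [ic|ci] := ltnP i (cap c).
  apply: eqv_trans (transfer ic hw) _; rewrite addnS -addSn.
  by apply: IHw => //; exact: ltnW.
have -> : i = cap c by lia.
rewrite (minn_idPr _) ?leq_addr // addKn; exact: eqv_refl.
Qed.

(** Linear in f, so that products of polynomials model products of forms modulo the minors;
    coefficients of f beyond [capsum cs] are dropped. *)
Definition pack cs (f : {poly K}) := \sum_(w < (capsum cs).+1) f`_w *: fill cs w.

Lemma pack_is_linear cs : linear (pack cs).
Proof.
move=> a f f'; rewrite /pack scaler_sumr -big_split; apply: eq_bigr => w _ /=.
by rewrite coefD coefZ scalerDl scalerA.
Qed.
HB.instance Definition _ cs := GRing.isLinear.Build K _ _ _ (pack cs) (pack_is_linear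
  cs).

Lemma packX cs w : (w <= capsum cs)%N -> pack cs 'X^w = fill cs w.
Proof.
rewrite -ltnS => hw; rewrite /pack (bigD1 (Ordinal hw)) //= coefXn eqxx scale1r.
by rewrite big1 ?addr0 // => i; rewrite -val_eqE coefXn /= => /negPf ->;
  rewrite scale0r.
Qed.

Lemma pack_cons cs c h f : (size h <= (cap c).+1)%N -> (size f <= (capsum cs).+1)%N ->
  eqv (zeta c h * pack cs f) (pack (c :: cs) (h * f)).
Proof.
move=> sh sf; move: h sh; apply: poly_lin_ind => [|h h' IH IH'|a h IH|i hi].
- by rewrite mul0r !linear0 mul0r; exact: eqv_refl.
- by rewrite mulrDl !linearD mulrDl; exact: eqvD.
- by rewrite -scalerAl !linearZ -scalerAl; exact: eqvZ.
move: f sf; apply: poly_lin_ind => [|h h' IH IH'|a h IH|w hw].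
- by rewrite mulr0 !linear0 mulr0; exact: eqv_refl.
- by rewrite mulrDr !linearD mulrDr; exact: eqvD.
- by rewrite -scalerAr !linearZ -scalerAr; exact: eqvZ.
rewrite -exprD !packX //; first exact: fill_cons.
by rewrite /capsum /= leq_add.
Qed.

Definition weqv cs cs' := capsum cs = capsum cs' /\
  forall w, (w <= capsum cs)%N -> eqv (fill cs w) (fill cs' w).

Lemma weqv_refl cs : weqv cs cs.
Proof. by split=> // w _; exact: eqv_refl. Qed.

Lemma weqv_trans cs1 cs2 cs3 : weqv cs1 cs2 -> weqv cs2 cs3 -> weqv cs1 cs3.
Proof.
move=> [e12 h12] [e23 h23]; split=> [|w hw]; first by rewrite e12.
by apply: eqv_trans (h12 w hw) _; apply: h23; rewrite -e12.
Qed.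

Lemma weqv_cons c cs cs' : weqv cs cs' -> weqv (c :: cs) (c :: cs').
Proof.
move=> [e h]; split=> [|w]; rewrite /capsum /= -/(capsum cs) -/(capsum cs') ?e // => hw.
by apply/eqvM/h; lia.
Qed.

(** Take the factor of block [c'] out of the greedy monomial, refill the rest with [c] in front by
    [fill_cons], then put [c'] back by the same lemma. *)
Lemma weqv_swap c c' cs : weqv (c :: c' :: cs) (c' :: c :: cs).
Proof.
split=> [|w hw]; first by rewrite /capsum /= addnCA.
set i := minn w (cap c); set w' := (w - i)%N; set j := minn w' (cap c').
rewrite -[fill (c :: c' :: cs) w]/(zeta c 'X^i * (zeta c' 'X^j * fill cs (w' - j)%N))
  mulrCA.
have hi : (i <= cap c)%N by rewrite /i geq_minr.
have hj : (j <= cap c')%N by rewrite /j geq_minr.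
have hw' : (w' - j <= capsum cs)%N.
  by move: hw; rewrite /j /w' /i /capsum /= -/(capsum cs); lia.
apply: eqv_trans (eqvM _ (fill_cons hi hw')) _.
have -> : w = (j + (i + (w' - j)))%N by rewrite /j /w' /i; lia.
by apply: fill_cons => //; rewrite /capsum /= leq_add.
Qed.

Definition word D k := nseq D false ++ nseq k true.

Lemma weqv_word D k : weqv (true :: word D k) (word D k.+1).
Proof.
elim: D => [|D IHD]; first exact: weqv_refl.
exact: weqv_trans (weqv_swap _ _ _) (weqv_cons _ IHD).
Qed.

Lemma capsum_word D k : capsum (word D k) = (D + k * m)%N.
Proof.
by rewrite /capsum map_cat sumn_cat !map_nseq !sumn_nseq mul1n mulnC.
Qed.

Lemma weqv_pack cs cs' f : weqv cs cs' -> eqv (pack cs f) (pack cs' f).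
Proof.
move=> [e h]; rewrite /pack -e; apply: eqv_sum => w _; apply/eqvZ/h.
by rewrite -ltnS.
Qed.

(** The map N_k in degree D + k. *)
Definition wpack D k f := pack (word D k) f.

Lemma wpack0 D k : wpack D k 0 = 0.
Proof. exact: linear0. Qed.

Lemma mul_wpack0 D k h f : (size h <= 2)%N -> (size f <= (D + k * m).+1)%N ->
  eqv (zeta false h * wpack D k f) (wpack D.+1 k (h * f)).
Proof. by move=> sh sf; apply: pack_cons => //; rewrite capsum_word. Qed.

Lemma mul_wpack1 D k h f : (size h <= m.+1)%N -> (size f <= (D + k * m).+1)%N ->
  eqv (zeta true h * wpack D k f) (wpack D k.+1 (h * f)).
Proof.
move=> sh sf; apply: eqv_trans (weqv_pack _ (weqv_word D k)).
by apply: pack_cons => //; rewrite capsum_word.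
Qed.

Lemma size_q : size q = 3%N.
Proof.
have q0 : q != 0 by apply: contra_eq_neq size_g => q0;
  rewrite g_fact q0 mulr0 size_poly0.
have := size_g; rewrite g_fact size_proper_mul ?size_XsubC => [[]//|].
by rewrite lead_coefXsubC mul1r lead_coef_eq0.
Qed.

(* Not a minor: these quadrics cut C + L out of the scroll. *)
Lemma curve_quadric f : (size f <= m.-1)%N ->
  quadrics4 (zeta false ('X - z%:P) * zeta true (q * f) + (-1) *: (zeta true 1 * zeta
    true (E * f))).
Proof.
move=> sf; have sqf : (size (q * f)%R <= m.+1)%N.
  by rewrite (leq_trans (size_polyMleq _ _)) // size_q; lia.
have sEf : (size (E * f)%R <= m.+1)%N.
  by rewrite (leq_trans (size_polyMleq _ _)) //; move: size_E; lia.
apply: quadrics4I => [|x Lx]; rewrite -!/(zeta _ _) scaleN1r.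
  rewrite rmorphB !rmorphM /= !pmeval_zeta ?size_XsubC ?size_poly1 //=.
  by rewrite {2}g_fact; ring.
by rewrite /mevalv mevalB -!/(mevalv _ x) !mevalvM !Lx ?mulr0 ?subrr ?size_poly1.
Qed.

(** Both sides pull back to E^(D+1) g^(k+2) f. One factor y and one factor u are split off and
    [curve_quadric] is applied to them. *)
Lemma wpack_reduce D k f : (size f <= D + k * m + m.-1)%N ->
  eqv (wpack D.+1 k.+1 (g * f)) (wpack D k.+2 (E * f)).
Proof.
have -> : (D + k * m + m.-1 = (D + k * m + m.-2).+1)%N by lia.
move: f; apply: poly_lin_ind => [|h h' IH IH'|a h IH|w hw].
- by rewrite !mulr0 /wpack !linear0; exact: eqv_refl.
- by rewrite !mulrDr /wpack !linearD; exact: eqvD.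
- by rewrite -!scalerAr /wpack !linearZ; exact: eqvZ.
(* [curve_quadric] takes degree at most m - 2; what remains is at most D + k m, the capacity of the
   other factors. *)
pose i := minn w m.-2; pose f := 'X^i : {poly K}; pose f' := 'X^(w - i) : {poly K}.
have -> : 'X^w = f * f' :> {poly K} by rewrite -exprD subnKC // geq_minl.
have sf : (size f <= m.-1)%N by rewrite size_polyXn /i; lia.
have sf' : (size f' <= (D + k * m).+1)%N by rewrite size_polyXn /i; lia.
have sqf : (size (q * f)%R <= m.+1)%N.
  by rewrite (leq_trans (size_polyMleq _ _)) // size_q; lia.
have sEf : (size (E * f)%R <= m.+1)%N.
  by rewrite (leq_trans (size_polyMleq _ _)) //; move: size_E; lia.
have sqff : (size (q * f * f')%R <= (D + k.+1 * m).+1)%N.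
  by rewrite (leq_trans (size_polyMleq _ _)) // mulSn; lia.
have sEff : (size (E * f * f')%R <= (D + k.+1 * m).+1)%N.
  by rewrite (leq_trans (size_polyMleq _ _)) // mulSn; lia.
have -> : g * (f * f') = ('X - z%:P) * (q * f * f') by rewrite g_fact !mulrA.
have -> : E * (f * f') = 1 * (E * f * f') by rewrite mul1r mulrA.
have s1 : (size ('X - z%:P)%R <= 2)%N by rewrite size_XsubC.
have s2 : (size (1%R : {poly K}) <= m.+1)%N by rewrite size_poly1.
apply: eqv_trans (eqv_sym (mul_wpack0 s1 sqff)) _.
apply: eqv_trans (eqvM _ (eqv_sym (mul_wpack1 sqf sf'))) _.
apply: eqv_sym; apply: eqv_trans (eqv_sym (mul_wpack1 s2 sEff)) _.
apply: eqv_trans (eqvM _ (eqv_sym (mul_wpack1 sEf sf'))) _.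
apply: eqv_sym; rewrite /eqv !mulrA -mulrBl mulrC; apply/ideal_genM/ideal_gen_mem.
by rewrite -[- (_ * _)]scaleN1r; exact: curve_quadric.
Qed.

(** * Normal forms modulo the quadrics *)

Definition packed d F := exists f : nat -> {poly K},
  (forall k, (k <= d)%N -> (size (f k) <= (d - k + k * m).+1)%N) /\
  eqv F (\sum_(k < d.+1) wpack (d - k) k (f k)).

(** By [var_dec] a variable is the sum of a form of the block (E, E X), which keeps the index k, and
    a form of the block of g, which raises it by one; [f1] and [f2] record the two contributions. *)
Lemma packedP d F : F \is d.-homog -> packed d F.
Proof.
move: d F; apply: dhomog_ind => [|d|d F G [f [sf Ff]] [h [sh Gh]]|d a F [f [sf Ff]]|].
- exists (fun=> 1); split=> [k _|]; first by rewrite size_poly1.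
  rewrite big_ord1 -[wpack _ _ _]/(pack [::] 'X^0) packX //; exact: eqv_refl.
- exists (fun=> 0); split=> [k _|]; first by rewrite size_poly0.
  by rewrite big1 => [|k _]; [exact: eqv_refl | rewrite /wpack linear0].
- exists (fun k => f k + h k); split=> [k kd|].
    by rewrite (leq_trans (size_polyD _ _)) // geq_max sf ?sh.
  by under eq_bigr do rewrite /wpack linearD; rewrite big_split; exact: eqvD.
- exists (fun k => a *: f k); split=> [k kd|].
    by rewrite (leq_trans (size_scale_leq _ _)) // sf.
  by under eq_bigr do rewrite /wpack linearZ; rewrite -scaler_sumr; exact: eqvZ.
move=> d j F [f [sf Ff]]; have [h [h' [sh sh' ->]]] := var_dec j.
pose f1 k := if (k <= d)%N then h * f k else 0.
pose f2 k := if k is k'.+1 then h' * f k' else 0.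
have sf1 k : (k <= d.+1)%N -> (size (f1 k) <= (d.+1 - k + k * m).+1)%N.
  rewrite /f1 => _; case: (leqP k d) => [kd|_]; last by rewrite size_poly0.
  by apply: leq_trans (size_polyMleq _ _) _; have := sf k kd; lia.
have sf2 k : (k <= d.+1)%N -> (size (f2 k) <= (d.+1 - k + k * m).+1)%N.
  case: k => [|k]; first by rewrite size_poly0.
  rewrite ltnS /f2 => kd; apply: leq_trans (size_polyMleq _ _) _.
  by have := sf k kd; rewrite mulSn; lia.
exists (fun k => f1 k + f2 k); split=> [k kd|].
  by rewrite (leq_trans (size_polyD _ _)) // geq_max sf1 ?sf2.
under eq_bigr do rewrite /wpack linearD; rewrite big_split mulrDl /=.
apply: eqvD; (apply: eqv_trans (eqvM _ Ff) _); rewrite mulr_sumr.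
- rewrite [X in eqv _ X]big_ord_recr /= {2}/f1 ltnn linear0 addr0.
  apply: eqv_sum => k _; have kd : (k <= d)%N by rewrite -ltnS.
  rewrite /f1 kd subSn //.
  by apply: mul_wpack0 => //; apply: sf; rewrite -ltnS.
- rewrite [X in eqv _ X]big_ord_recl /= linear0 add0r.
  apply: eqv_sum => k _; rewrite /bump add1n subSS.
  by apply: mul_wpack1 => //; apply: sf; rewrite -ltnS.
Qed.

Lemma fill_homog cs w : fill cs w \is (size cs).-homog.
Proof.
elim: cs w => [|c cs IHcs] w /=; first exact: dhomog1.
by rewrite -add1n dhomogM // lin_homog.
Qed.

Lemma wpack_homog D k f : wpack D k f \is (D + k).-homog.
Proof.
apply: rpred_sum => w _; apply: rpredZ.
by have := fill_homog (word D k) w; rewrite size_cat !size_nseq.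
Qed.

Lemma pmeval_fill cs w : (w <= capsum cs)%N ->
  pmeval v (fill cs w) = \prod_(c <- cs) base c * 'X^w.
Proof.
elim: cs w => [|c cs IHcs] w hw /=.
  by move: hw; rewrite leqn0 => /eqP ->; rewrite big_nil rmorph1 mulr1.
rewrite /capsum /= -/(capsum cs) in hw.
rewrite rmorphM /= pmeval_zeta ?size_polyXn ?ltnS ?geq_minr // IHcs; last lia.
by rewrite big_cons mulrACA -exprD subnKC // geq_minl.
Qed.

Lemma pmeval_wpack D k f : (size f <= (D + k * m).+1)%N ->
  pmeval v (wpack D k f) = E ^+ D * g ^+ k * f.
Proof.
move: f; apply: poly_lin_ind => [|h h' IH IH'|a h IH|w hw].
- by rewrite /wpack linear0 rmorph0 mulr0.
- by rewrite /wpack linearD rmorphD IH IH' /= mulrDr.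
- by rewrite /wpack linearZ /= pmevalZ IH -scalerAr.
rewrite /wpack packX ?capsum_word // pmeval_fill ?capsum_word //.
by rewrite big_cat /= !big_nseq !iter_mulr_1.
Qed.

Lemma fill_line cs w x : true \in cs -> on_line x -> mevalv (fill cs w) x = 0.
Proof.
move=> tcs Lx; elim: cs w tcs => [|c cs IHcs] w //=.
rewrite inE mevalvM => /orP [/eqP <-|/IHcs ->]; last by rewrite mulr0.
by rewrite Lx ?mul0r // size_polyXn ltnS geq_minr.
Qed.

Lemma wpack_line D k f x : on_line x -> mevalv (wpack D k.+1 f) x = 0.
Proof.
move=> Lx; rewrite /wpack /pack /mevalv raddf_sum big1 // => w _ /=.
rewrite mevalZ -/(mevalv _ _) fill_line ?mulr0 //.
by rewrite mem_cat [X in _ || X]inE eqxx orbT.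
Qed.

(** N_0(f) is the binary form with dehomogenization f in the coordinates y_0, y_1 of L. *)
Lemma wpack0_line D f x t : mevalv (zeta false 1) x = 1 ->
  mevalv (zeta false 'X) x = t -> (size f <= D.+1)%N ->
  mevalv (wpack D 0 f) x = f.[t].
Proof.
move=> x0 x1; move: f; apply: poly_lin_ind => [|h h' IH IH'|a h IH|w hw].
- by rewrite /wpack linear0 horner0 /mevalv meval0.
- by rewrite /wpack linearD hornerD -IH -IH' /mevalv mevalD.
- by rewrite /wpack linearZ hornerZ -IH /mevalv mevalZ.
rewrite /wpack packX ?capsum_word ?addn0 // /word cats0 hornerXn.
elim: D w hw => [|D IHD] w hw /=; first by move: hw; rewrite leqn0 => /eqP ->;
  exact: meval1.
rewrite mevalvM; case: w hw => [|w] hw; first by rewrite min0n subn0 x0 IHD // mulr1.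
have -> : minn w.+1 1 = 1%N by lia.
by rewrite x1 subn1 IHD // exprS.
Qed.

(** Induction on the number of terms. All terms but the first contain g^(k+2), so g divides E^(D+1)
    f_0, hence f_0; [wpack_reduce] then moves the first term into the second. *)
Lemma wpack_eliminate D k (f : nat -> {poly K}) :
    (forall j, (j <= D)%N -> (size (f j) <= (D - j + (k.+1 + j) * m).+1)%N) ->
    \sum_(j < D.+1) E ^+ (D - j) * g ^+ (k.+1 + j) * f j = 0 ->
  ideal_gen quadrics4 (\sum_(j < D.+1) wpack (D - j) (k.+1 + j) (f j)).
Proof.
have g0 : g != 0 by rewrite -size_poly_eq0 size_g.
elim: D k f => [|D IHD] k f sf.
  rewrite !big_ord1 subnn mul1r addn0 => /eqP;
    rewrite mulf_eq0 expf_eq0 (negPf g0) andbF /=.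
  by move/eqP ->; rewrite /wpack linear0; exact: ideal_gen0.
rewrite big_ord_recl /= addn0 subn0 => eq0; rewrite big_ord_recl /= addn0 subn0.
have [f' f0E] : exists f', f 0%N = g * f'.
  have: g %| E ^+ D.+1 * f 0%N.
    rewrite -(@dvdp_mul2l _ (g ^+ k.+1)) ?expf_neq0 //.
    rewrite mulrA [g ^+ _ * E ^+ _]mulrC.
    move/eqP: eq0; rewrite addr_eq0 => /eqP ->; rewrite -exprSr dvdpNr.
    apply: dvdp_sum => i _.
    by rewrite dvdp_mulr // dvdp_mull // dvdp_exp2l // /bump; lia.
  rewrite Gauss_dvdpr ?coprimep_expr //.
  by move=> /dvdpP [f' ->]; exists f'; rewrite mulrC.
have sf' : (size f' <= D + k * m + m.-1)%N.
  have [->|f'0] := eqVneq f' 0; first by rewrite size_poly0.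
  have := sf 0%N isT; rewrite f0E size_mul // size_g addn0 mulSn.
  move: (size f') (k * m)%N hm; clear; lia.
(* The new family, shifted by one index; its first member absorbs the term coming from f_0 = g
   f'. *)
pose h j := if j is j'.+1 then f j'.+2 else E * f' + f 1%N.
have IH : ideal_gen quadrics4 (\sum_(j < D.+1) wpack (D - j) (k.+2 + j) (h j)).
  apply: IHD => [[|j] hj|].
  - rewrite /h (leq_trans (size_polyD _ _)) // geq_max.
    rewrite addn0 subn0; have := sf 1%N isT; rewrite addn1 subSS subn0 => ->.
    rewrite andbT; apply: leq_trans (size_polyMleq _ _) _; move: size_E sf'.
    by rewrite !mulSn; move: (size E) (size f') (k * m)%N hm; clear; lia.
  - by have := sf j.+2 hj; rewrite subSS -addSnnS.
  - rewrite big_ord_recl /= mulrDr -[RHS]eq0 f0E subn0 addn0 -addrA; congr (_ + _).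
      by rewrite !exprS; ring.
    rewrite [in RHS]big_ord_recl /= addn1 subSS subn0; congr (_ + _).
    by apply: eq_bigr => i _; rewrite /bump /= !add1n !subSS !addSnnS.
have sum2 : \sum_(i < D.+1) wpack (D.+1 - bump 0 i) (k.+1 + bump 0 i) (f (bump 0 i)) =
    \sum_(j < D.+1) wpack (D - j) (k.+2 + j) (h j) - wpack D k.+2 (E * f').
  rewrite !big_ord_recl /= subSS !subn0 addn1 addn0 addrAC; congr (_ + _).
    by rewrite /wpack linearD addrAC subrr add0r.
  by apply: eq_bigr => i _; rewrite /bump /= !add1n !subSS !addSnnS.
rewrite sum2 f0E addrCA; apply: ideal_genD => //; exact: wpack_reduce.
Qed.

Theorem ideal_rank4 d F : F \is d.-homog -> pmeval v F = 0 ->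
  (forall x, on_line x -> mevalv F x = 0) -> ideal_gen quadrics4 F.
Proof.
move=> /packedP [f [sf Ff]] F0 FL.
have G0 : \sum_(k < d.+1) E ^+ (d - k) * g ^+ k * f k = 0.
  have : pmeval v (F - \sum_(k < d.+1) wpack (d - k) k (f k)) = 0.
    by apply: ideal_gen_ker Ff => G [].
  rewrite rmorphB /= F0 sub0r rmorph_sum /= => /eqP; rewrite oppr_eq0 => /eqP e.
  rewrite -[RHS]e.
  by apply: eq_bigr => k _; rewrite pmeval_wpack // sf // -ltnS.
(* On L only N_0 survives, and its values there are those of f_0. *)
have f0 : f 0%N = 0.
  have sf0 := sf 0%N isT; rewrite subn0 addn0 in sf0.
  have root0 t : (f 0%N).[t] = 0.
    have [x [Lx x0 x1]] := line_pt t.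
    have : mevalv (F - \sum_(k < d.+1) wpack (d - k) k (f k)) x = 0.
      by apply: (ideal_gen_ker (f := meval (fun i => x 0 i))) Ff => G [_ _ _]; exact.
    rewrite /mevalv mevalB -!/(mevalv _ x) FL // sub0r mevalv_sum big_ord_recl subn0.
    rewrite [X in _ + X]big1 => [|i _]; last by rewrite lift0 wpack_line.
    by rewrite addr0 (wpack0_line x0 x1) // => /eqP; rewrite oppr_eq0 => /eqP.
  by apply: (@poly_root_eq0 _ _ [::]).
rewrite -[F](subrK (\sum_(k < d.+1) wpack (d - k) k (f k))); apply: ideal_genD => //.
rewrite big_ord_recl f0 /wpack linear0 add0r.
case: d sf Ff G0 F0 FL => [|d] sf Ff G0 F0 FL; first by rewrite big_ord0;
  exact: ideal_gen0.
apply: (@wpack_eliminate d 0 (fun k => f k.+1)) => [j hj|].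
  exact: (sf j.+1).
by move: G0; rewrite big_ord_recl f0 mulr0 add0r.
Qed.

End Scroll.

(** * Hyperplanes of binary forms containing no multiple of a quadratic *)

Section NoQuadratic.
Variables (K : fieldType) (n : nat) (p : nat -> K).

(** The sequence [p] stands for the functional X^i -> p_i on S_n; the recurrence says that (a + b X
    + c X^2) S_(n-2) lies in its kernel. *)
Definition no_quadratic := forall a b c,
  (forall i, (i.+2 <= n)%N -> a * p i + b * p i.+1 + c * p i.+2 = 0) ->
  [/\ a = 0, b = 0 & c = 0].

Hypotheses (hn : (2 <= n)%N) (nq : no_quadratic).

Lemma no_linear a b : (forall i, (i < n)%N -> a * p i + b * p i.+1 = 0) -> a = 0 /\ b =
  0.
Proof.
move=> h; have [|-> -> _ //] := @nq a b 0.
by move=> i hi; rewrite mul0r addr0 h // ltnW.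
Qed.

(** If all these minors vanished, then for each k < n the coefficients p_(k+1), -p_k would give a
    recurrence of order 1, so p_k = 0; but then 1, 0 gives another one. *)
Lemma no_quadratic_minor :
  exists k l, [/\ (k < n)%N, (l < n)%N & p k.+1 * p l - p l.+1 * p k != 0].
Proof.
case: (boolP [exists k : 'I_n, exists l : 'I_n, p k.+1 * p l - p l.+1 * p k != 0]).
  by move=> /existsP [k /existsP [l kl]]; exists k, l; split.
rewrite negb_exists => /forallP h.
have p0 k : (k < n)%N -> p k = 0.
  move=> hk; have [|_ /eqP] := @no_linear (p k.+1) (- p k).
    move=> l hl; have := h (Ordinal hk);
      rewrite negb_exists => /forallP /(_ (Ordinal hl)).
    by rewrite negbK => /eqP /= <-; ring.
  by rewrite oppr_eq0 => /eqP.
have [|/eqP] := @no_linear 1 0; last by rewrite oner_eq0.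
by move=> i /p0 ->; rewrite mulr0 mul0r addr0.
Qed.

(* Comparing f (i + 1 + j) with f (i + (j + 1)) puts both shifts of a in the
   span of the shifts of p, which makes p satisfy a recurrence of order 2. *)
Lemma hankel_rank2 (K2 : (2%:R : K) != 0) (a f : nat -> K) :
  (forall i j, (i <= n)%N -> (j <= n)%N -> f (i + j)%N = p i * a j + p j * a i) ->
  forall j, (j <= n)%N -> a j = 0.
Proof.
move=> hf; have [k [l [hk hl]]] := no_quadratic_minor.
set D := _ - _ => D0.
have sh i j : (i < n)%N -> (j < n)%N ->
    p i.+1 * a j + p j * a i.+1 = p i * a j.+1 + p j.+1 * a i.
  move=> hi hj; rewrite -hf ?addSnnS ?hf //; exact: ltnW.
(* Cramer's rule for a_i and a_(i+1) in the equations [sh i k] and [sh i l], whose determinant is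
   D. *)
pose b' := p l * a k - p k * a l; pose a' := p k * a l.+1 - p l * a k.+1.
pose d' := p l.+1 * a k - p k.+1 * a l; pose c' := p k.+1 * a l.+1 - p l.+1 * a k.+1.
have e1 i : (i < n)%N -> D * a i = b' * p i.+1 + a' * p i.
  move=> hi; have h1 := sh i k hi hk; have h2 := sh i l hi hl.
  have -> : D * a i = p l * (p k.+1 * a i) - p k * (p l.+1 * a i) by rewrite /D; ring.
  have -> : p k.+1 * a i = p i.+1 * a k + p k * a i.+1 - p i * a k.+1 by rewrite h1;
    ring.
  have -> : p l.+1 * a i = p i.+1 * a l + p l * a i.+1 - p i * a l.+1 by rewrite h2;
    ring.
  by rewrite /b' /a'; ring.
have e2 i : (i < n)%N -> D * a i.+1 = d' * p i.+1 + c' * p i.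
  move=> hi; have h1 := sh i k hi hk; have h2 := sh i l hi hl.
  have -> : D * a i.+1 = p k.+1 * (p l * a i.+1) - p l.+1 * (p k * a i.+1) by rewrite
    /D; ring.
  have -> : p l * a i.+1 = p i * a l.+1 + p l.+1 * a i - p i.+1 * a l by rewrite -h2;
    ring.
  have -> : p k * a i.+1 = p i * a k.+1 + p k.+1 * a i - p i.+1 * a k by rewrite -h1;
    ring.
  by rewrite /c' /d'; ring.
have [|c0 ad b0] := @nq (- c') (a' - d') b'.
  move=> i hi; have := e1 i.+1 hi; rewrite e2 ?(ltnW hi) // => e.
  have -> : - c' * p i + (a' - d') * p i.+1 + b' * p i.+2 =
    b' * p i.+2 + a' * p i.+1 - (d' * p i.+1 + c' * p i) by ring.
  by rewrite e subrr.
(* The recurrence forces b' = c' = 0 and a' = d', so a is proportional to p; the last index i = n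
   comes from [e2]. *)
have ea i : (i <= n)%N -> D * a i = a' * p i.
  rewrite leq_eqVlt => /orP [/eqP ->|/e1 ->]; last by rewrite b0; ring.
  rewrite -(prednK (ltnW hn)) e2; last by rewrite prednK ?(ltnW hn).
  move/eqP: c0; rewrite oppr_eq0 => /eqP ->; move/subr0_eq: ad => <-; ring.
(* Inserting this proportionality into [sh k l] leaves 2 a' D = 0. *)
have a'0 : a' = 0.
  apply/eqP; have := sh k l hk hl; move/(congr1 ( *%R D)); rewrite !mulrDr.
  rewrite !(mulrCA D) !ea ?(ltnW hk) ?(ltnW hl) // => e.
  have : 2%:R * a' * D == 0 by rewrite /D -subr_eq0 -(subr0 (_ * _)); move/eqP: e;
    rewrite -subr_eq0 => /eqP e; apply/eqP; rewrite subr0 subr0 -[RHS]e; ring.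
  by rewrite !mulf_eq0 (negPf D0) (negPf K2) orbF.
move=> j /ea; rewrite a'0 mul0r => /eqP; rewrite mulf_eq0 (negPf D0).
by move/eqP.
Qed.

End NoQuadratic.

(** The combination is a gcd of the family, obtained by iterating the identity for two
    polynomials. *)
Lemma Bezout_family (K : fieldType) k (w : 'I_k -> {poly K}) :
  exists a : 'I_k -> {poly K}, forall i, \sum_j a j * w j %| w i.
Proof.
elim: k w => [|k IHk] w; first by exists (fun=> 0) => -[].
have [a ha] := IHk (fun i => w (lift ord0 i)).
set h := \sum_j _ in ha; have [[u1 u2] /= hu] := Bezoutp (w ord0) h.
exists (fun i => if unlift ord0 i is Some j then u2 * a j else u1) => i.
have -> : \sum_j (if unlift ord0 j is Some j0 then u2 * a j0 else u1) * w j =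
    u1 * w ord0 + u2 * h.
  rewrite big_ord_recl unlift_none mulr_sumr; congr (_ + _).
  by apply: eq_bigr => j _; rewrite liftK mulrA.
rewrite (eqp_dvdl _ hu); case: (unliftP ord0 i) => [j|] ->; last exact: dvdp_gcdl.
exact: dvdp_trans (dvdp_gcdr _ _) (ha j).
Qed.

Lemma rVpoly_sum (K : fieldType) k (x : 'rV[K]_k) : rVpoly x = \sum_i x 0 i *: 'X^i.
Proof. by rewrite [LHS]poly_def; apply: eq_bigr => i _; rewrite valK. Qed.

(** * The hyperplane V, spanned by the coordinates of the parametrization *)

Section Hyperplane.
Variables (K : closedFieldType) (K2 : (2%:R : K) != 0) (n m : nat).
Hypotheses (hn : n = m.+3) (hm : (2 <= m)%N).
Variables (A : 'M[K]_(n, n.+1)) (p : nat -> K).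
Hypotheses (freeA : row_free A) (nq : no_quadratic n p).
Implicit Types (f h x : {poly K}).

Definition pairing f := \sum_(i < n.+1) f`_i * p i.

Lemma pair_is_linear : linear (pairing : {poly K} -> K^o).
Proof.
move=> a f h; rewrite /pairing scaler_sumr -big_split; apply: eq_bigr => i _ /=.
by rewrite coefD coefZ mulrDl -mulrA.
Qed.
HB.instance Definition _ := GRing.isLinear.Build K {poly K} K^o _ pairing
  pair_is_linear.

Hypothesis pairA : forall f, (size f <= n.+1)%N -> pairing f = 0 <-> (poly_rV f <=
  A)%MS.

Lemma pairX i : (i <= n)%N -> pairing 'X^i = p i.
Proof.
rewrite -ltnS => hi; rewrite /pairing (bigD1 (Ordinal hi)) //= coefXn eqxx mul1r.
rewrite big1 ?addr0 // => j; rewrite -val_eqE coefXn /= => /negPf ->; exact: mul0r.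
Qed.

Lemma pair_quadratic x : (size x <= 3)%N ->
  (forall f, (size f <= n.-1)%N -> pairing (x * f) = 0) -> x = 0.
Proof.
move=> sx hx; have [|x0 x1 x2] := @nq x`_0 x`_1 x`_2.
  move=> i hi; rewrite -!pairX //; try lia.
  rewrite -[RHS](hx 'X^i) ?size_polyXn; last lia.
  rewrite -[x in RHS](coefK x) (_ : \poly_(_ < _) _ = \poly_(i < 3) x`_i).
    rewrite poly_def !big_ord_recr big_ord0 /= add0r !mulrDl !linearD /=.
    by rewrite -!scalerAl !linearZ /= mul1r -!exprD.
  by rewrite coefK; apply/polyP => k; rewrite coef_poly; case: ltnP => // h;
    rewrite nth_default // (leq_trans sx).
apply/polyP => i; rewrite coef0; case: i => [|[|[|i]]] //.
by rewrite nth_default // (leq_trans sx).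
Qed.

Definition par (j : 'I_n) : {poly K} := rVpoly (row j A).

Lemma size_par j : (size (par j) <= n.+1)%N.
Proof. exact: size_poly. Qed.

Lemma sum_par (c : 'rV[K]_n) : \sum_j c 0 j *: par j = rVpoly (c *m A).
Proof.
rewrite mulmx_sum_row linear_sum; apply: eq_bigr => j _.
by rewrite linearZ.
Qed.

(** On V this inverts the pullback of linear forms, which is injective because [A] is row free. *)
Definition xi f : 'rV[K]_n := poly_rV f *m pinvmx A.

Lemma xi_is_linear : linear xi.
Proof. by move=> a f h; rewrite /xi linearP mulmxDl scalemxAl. Qed.
HB.instance Definition _ := GRing.isLinear.Build K {poly K} 'rV[K]_n _ xi xi_is_linear.

Lemma xiK f : (size f <= n.+1)%N -> pairing f = 0 -> \sum_j xi f 0 j *: par j = f.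
Proof.
move=> sf /(pairA sf) fA; rewrite sum_par /xi mulmxKpV // poly_rV_K //.
Qed.

Lemma xi_par (c : 'rV[K]_n) : xi (\sum_j c 0 j *: par j) = c.
Proof. by rewrite sum_par /xi rVpolyK -mulmxA mulmxVp // mulmx1. Qed.

Lemma pair_par j : pairing (par j) = 0.
Proof. by apply/pairA; rewrite ?size_par // /par rVpolyK row_sub. Qed.

Lemma pair_sum_par (c : 'rV[K]_n) : pairing (\sum_j c 0 j *: par j) = 0.
Proof.
by rewrite linear_sum big1 // => j _; rewrite linearZ /= pair_par scaler0.
Qed.

Lemma size_sum_par (c : 'rV[K]_n) : (size (\sum_j c 0 j *: par j)%R <= n.+1)%N.
Proof. by rewrite sum_par size_poly. Qed.

(** This is V V = S_(2n). A functional [L] that kills all products has L(X^(i+j)) = p_i a_j + p_j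
    a_i because V has codimension 1, and [hankel_rank2] then gives a = 0. *)
Lemma quadratic_normality w : (w <= n.*2)%N ->
  exists H, H \is 2.-homog /\ pmeval par H = 'X^w.
Proof.
move=> hw; pose T : finType := ('I_n * 'I_n)%type.
pose B := \matrix_(r < #|T|)
  (poly_rV (par (enum_val r).1 * par (enum_val r).2) : 'rV[K]_(n.*2.+1)).
have sB i j : (size (par i * par j)%R <= n.*2.+1)%N.
  by apply: leq_trans (size_polyMleq _ _) _; have := size_par i; have := size_par j;
    lia.
have [fullB|nfullB] := boolP (row_full B).
  have /submxP [x hx] := submx_full (poly_rV 'X^w : 'rV[K]_(n.*2.+1)) fullB.
  exists (\sum_r x 0 r *: ('X_(enum_val r).1 * 'X_(enum_val r).2)); split.
    apply: rpred_sum => r _; apply: rpredZ; rewrite -[2%N]/(1 + 1)%N.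
    by apply: dhomogM; rewrite dhomogX /= mdeg1.
  rewrite rmorph_sum -[RHS](@poly_rV_K _ n.*2.+1) ?size_polyXn // hx mulmx_sum_row.
  rewrite linear_sum; apply: eq_bigr => r _ /=.
  by rewrite pmevalZ linearZ rmorphM /= !pmevalX rowK poly_rV_K.
have [y yB y0] : exists2 y : 'rV_(n.*2.+1), (y <= kermx B^T)%MS & y != 0.
  by apply/rowV0Pn; rewrite kermx_eq0 /row_free mxrank_tr.
pose l f := \sum_(k < n.*2.+1) f`_k * y 0 k.
have lD f h a : l (a *: f + h) = a * l f + l h.
  rewrite /l mulr_sumr -big_split; apply: eq_bigr => i _ /=.
  by rewrite coefD coefZ mulrDl -mulrA.
pose Ml := GRing.isLinear.Build K {poly K} K^o _ (l : {poly K} -> K^o) (fun a f h => lD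
  f h a).
pose L : {linear {poly K} -> K^o} := HB.pack (l : {poly K} -> K^o) Ml.
have L0 i j : L (par i * par j) = 0.
  move/sub_kermxP: yB => /matrixP /(_ 0 (enum_rank ((i, j) : T))).
  rewrite !mxE => e; rewrite -[RHS]e /= /l; apply: eq_bigr => k _.
  by rewrite !mxE enum_rankK mulrC.
have LV f h : (size f <= n.+1)%N -> (size h <= n.+1)%N -> pairing f = 0 -> pairing h =
  0 ->
    L (f * h) = 0.
  move=> sf sh f0 h0; rewrite -(xiK sf f0) -(xiK sh h0) mulr_suml linear_sum big1 // =>
    i _.
  rewrite mulr_sumr linear_sum big1 // => j _.
  by rewrite -scalerAl -scalerAr scalerA linearZ L0; exact: mulr0.
have [i0 hi0 pi0] : exists2 i, (i <= n)%N & p i != 0.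
  case: (boolP [exists i : 'I_n.+1, p i != 0]) => [/existsP [i pi0]|].
    by exists i => //; rewrite -ltnS.
  rewrite negb_exists => /forallP h; have [|/eqP] := @nq 1 0 0;
    last by rewrite oner_eq0.
  move=> i hi; have /ltnW/ltnW hi' : (i.+2 < n.+1)%N by [].
  by have := h (Ordinal hi'); rewrite negbK => /eqP /= ->; ring.
(* Since e pairs to 1, each X^i - p_i e lies in V. *)
pose e : {poly K} := (p i0)^-1 *: 'X^i0.
have se : (size e <= n.+1)%N by rewrite (leq_trans (size_scale_leq _ _)) ?size_polyXn.
have pe : pairing e = 1 by rewrite linearZ /= pairX //; exact: mulVf.
(* Expanding L((X^i - p_i e)(X^j - p_j e)) = 0 leaves a term p_i p_j L(e e), shared equally between
   a_i and a_j. *)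
pose a j := L (e * 'X^j) - p j * L (e * e) / 2%:R.
pose f k := L 'X^k.
have hf i j : (i <= n)%N -> (j <= n)%N -> f (i + j)%N = p i * a j + p j * a i.
  move=> hi hj.
  have := LV ('X^i - p i *: e) ('X^j - p j *: e).
  have sx k : (k <= n)%N -> (size ('X^k - p k *: e)%R <= n.+1)%N.
    move=> hk; rewrite (leq_trans (size_polyD _ _)) // geq_max size_polyXn ltnS hk.
    by rewrite size_polyN (leq_trans (size_scale_leq _ _)).
  have px k : (k <= n)%N -> pairing ('X^k - p k *: e) = 0.
    by move=> hk; rewrite linearB linearZ /= pairX // pe /GRing.scale /= mulr1 subrr.
  rewrite !sx ?px // => /(_ isT isT erefl erefl).
  have -> : ('X^i - p i *: e) * ('X^j - p j *: e) =
    'X^(i + j) - p i *: (e * 'X^j) - p j *: (e * 'X^i) + (p i * p j) *: (e * e).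
    by rewrite exprD -!mul_polyC polyCM; ring.
  rewrite !linearD !linearN !linearZ => E0.
  have {}E0 : L 'X^(i + j) + p i * - L (e * 'X^j) + p j * - L (e * 'X^i) +
    p i * p j * L (e * e) = 0 by exact: E0.
  rewrite /f /a; move: E0;
    move: (L _ : K) (L (e * 'X^j) : K) (L (e * 'X^i) : K) (L (e * e) : K).
  move=> x1 x2 x3 x4 E0; rewrite -[x1]subr0 -E0; field.
  exact: K2.
have a0 : forall j, (j <= n)%N -> a j = 0.
  by apply: (@hankel_rank2 _ _ p _ nq K2 a f); first lia.
case/negP: y0; apply/eqP/rowP => k; rewrite mxE.
have yE (k' : 'I_(n.*2.+1)) : y 0 k' = L 'X^k'.
  rewrite /= /l (bigD1 k') //= coefXn eqxx mul1r big1 ?addr0 // => j.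
  by rewrite -val_eqE coefXn /= => /negPf ->; rewrite mul0r.
(* Each exponent up to 2n is a sum of two exponents up to n. *)
have kE : (k = minn k n + (k - minn k n) :> nat)%N by lia.
rewrite yE -/(f k) kE hf ?a0 ?mulr0 ?addr0 //; have := ltn_ord k; lia.
Qed.

Lemma even_normality k f : (size f <= (k * n.*2).+1)%N ->
  exists H, H \is (k * 2).-homog /\ pmeval par H = f.
Proof.
move: f; apply: poly_lin_ind => [|f h [F [hF <-]] [G [hG <-]]|a f [F [hF <-]]|w hw].
- by exists 0; rewrite rpred0 rmorph0.
- by exists (F + G); rewrite rpredD // rmorphD.
- by exists (a *: F); rewrite rpredZ // pmevalZ.
elim: k w hw => [|k IHk] w hw.
  by exists 1; rewrite rmorph1 dhomog1; move: hw; rewrite leqn0 => /eqP ->.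
have [|F [hF eF]] := IHk (w - n.*2)%N; first by rewrite mulSn in hw; lia.
have [H [hH eH]] := @quadratic_normality (minn w n.*2) (geq_minr _ _).
exists (H * F); rewrite rmorphM /= eH eF -exprD; split; first by rewrite mulSn dhomogM.
by congr ('X^_); lia.
Qed.

(** * The cubic defined by the trisecant line *)

Section Trisecant.
Variables (C : 'rV[K]_n -> Prop) (L : 'M[K]_(2, n)) (c0 : 'rV[K]_n).
Hypotheses (freeL : row_free L) (lenCL : length_ge (inter_ideal C L) 3).
Hypothesis C_par : forall d F, F \is d.-homog -> pmeval par F = 0 -> vanishes_on C F.
Hypotheses (c0L : c0 *m L^T = 0) (size_c0 : size (\sum_j c0 0 j *: par j) = n.+1).

Lemma vanishes_on_line c : c *m L^T = 0 -> vanishes_on (pts_line L) (lin c).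
Proof.
move=> cL x [_ /submxP [y ->]]; rewrite mevalv_lin -mulmxA.
have -> : L *m c^T = 0 by rewrite -[LHS]trmxK trmx_mul trmxK cL trmx0.
by rewrite mulmx0 mxE.
Qed.

Let w i := \sum_j (row i (kermx L^T)) 0 j *: par j.

(* The pullbacks w i of the forms vanishing on L generate h K[X], and in large degree the
   length of the intersection of C and L is at most deg h.  The division by the pullback
   of c0, of full degree n, keeps the Bezout coefficients small. *)
Lemma trisecant_gcd : exists h, [/\ (4 <= size h)%N, h != 0 & forall i, h %| w i].
Proof.
have [a ha] := Bezout_family w; set h := \sum_j _ in ha; exists h.
pose w0 := \sum_j c0 0 j *: par j.
have hw0 : h %| w0.
  have /submxP [y hy] : (c0 <= kermx L^T)%MS by apply/sub_kermxP.
  have -> : w0 = \sum_i y 0 i *: w i.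
    rewrite /w0 sum_par hy -mulmxA mulmx_sum_row linear_sum; apply: eq_bigr => i _.
    by rewrite linearZ row_mul /w sum_par.
  by apply: dvdp_sum => i _; rewrite -mul_polyC dvdp_mull // ha.
have w00 : w0 != 0 by rewrite -size_poly_eq0 size_c0.
have h0 : h != 0 by apply: contraNneq w00 => e; move: hw0; rewrite e dvd0p.
split=> //; rewrite leqNgt; apply/negP => sh.
(* An odd degree: cofactors of degree 2k, available from [even_normality], times a linear form
   vanishing on L. *)
have [d0 hd0] := lenCL; pose k := d0.+1; pose d := (k * 2).+1.
have [|f [hf indf]] := hd0 d; first by rewrite /d /k; lia.
(* If deg h <= 2, three remainders modulo h are linearly dependent. *)
pose B := \matrix_i (poly_rV (pmeval par (f i) %% h) : 'rV[K]_2).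
have [b bB b0] : exists2 b : 'rV_3, (b <= kermx B)%MS & b != 0.
  apply/rowV0Pn; rewrite kermx_eq0 /row_free neq_ltn.
  by rewrite (leq_ltn_trans (rank_leq_col _)).
case/negP: b0; apply/eqP/rowP => i; rewrite mxE; apply: (indf (fun i => b 0 i)) => {i}.
set F := \sum_i _; have hF : F \is d.-homog by apply: rpred_sum => i _; exact: rpredZ.
have : h %| pmeval par F.
  rewrite /dvdp; move/sub_kermxP: bB => /(congr1 rVpoly);
    rewrite linear0 mulmx_sum_row linear_sum => e.
  rewrite rmorph_sum (big_morph _ (modpD h) (mod0p h)) -[X in _ == X]e;
    apply/eqP/eq_bigr => i _ /=.
  rewrite pmevalZ modpZl linearZ rowK /= poly_rV_K //.
  by rewrite -2!ltnS (leq_ltn_trans _ sh) // ltn_modp.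
case/dvdpP => u hu.
pose r i := (a i * u) %% w0.
have sr i : (size (r i * w i)%R <= n.*2)%N.
  have s1 : (size (r i) < n.+1)%N by rewrite -size_c0 ltn_modp.
  have s2 : (size (w i) <= n.+1)%N by exact: size_sum_par.
  apply: leq_trans (size_polyMleq _ _) _; move: s1 s2.
  by move: (size (r i)) (size (w i)); clear; lia.
pose S := \sum_i r i * w i.
have [b' eb] : exists b', pmeval par F - S = b' * w0.
  exists (\sum_i (a i * u) %/ w0 * w i);
    rewrite hu mulrC /h /S mulr_suml mulr_suml -sumrB.
  apply: eq_bigr => i _; rewrite mulrAC [X in X * _ - _](divp_eq _ w0) /r; ring.
have sF : (size (pmeval par F) <= (n * d).+1)%N by apply: size_pmeval hF => j;
  exact: size_par.
have nd : (n * d = k * n.*2 + n)%N by rewrite /d -muln2; clear; lia.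
have sb : (size b' <= (k * n.*2).+1)%N.
  have [->|nb'] := eqVneq b' 0; first by rewrite size_poly0.
  have : (size (b' * w0)%R <= (n * d).+1)%N.
    rewrite -eb (leq_trans (size_polyD _ _)) // geq_max sF size_polyN.
    apply: (big_ind (fun x : {poly K} => (size x <= (n * d).+1)%N)) => [|x y hx hy|i _].
    - by rewrite size_poly0.
    - by rewrite (leq_trans (size_polyD _ _)) // geq_max hx.
    - by apply: leq_trans (sr i) _; rewrite nd /k mulSn; clear; lia.
  rewrite size_mul // size_c0 nd; move: (size b') (k * n.*2)%N; clear; lia.
have lift_r i : exists H, H \is (k * 2).-homog /\ pmeval par H = r i.
  apply: even_normality; have : (size (r i) < n.+1)%N by rewrite -size_c0 ltn_modp.
  by rewrite /k mulSn; move: (size (r i)); clear; lia.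
have [Hb [hHb eHb]] := even_normality sb.
have [R hR] : exists R : 'I_n -> {mpoly K[n]}, forall i, R i \is (k * 2).-homog /\
  pmeval par (R i) = r i.
  have := fin_all_exists lift_r; by [].
(* G lies in the ideal of L and has the same pullback as F, so F - G lies in the ideal of C. *)
pose G := \sum_i R i * lin (row i (kermx L^T)) + Hb * lin c0.
have dM H c : H \is (k * 2).-homog -> H * lin c \is d.-homog.
  by move=> hH; rewrite -[d]addn1; apply: dhomogM hH (lin_homog c).
have hFG : F - G \is d.-homog.
  by rewrite rpredB // rpredD ?dM // rpred_sum // => i _; apply: dM; have [] := hR i.
exists (F - G), G; split; last by rewrite subrK.
  apply: ideal_gen_mem; split; first by exists d.
  apply: (C_par hFG).
  have eG : pmeval par G = S + b' * w0.
    rewrite rmorphD rmorph_sum rmorphM; congr (_ + _);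
      last by rewrite /= eHb pmeval_lin.
    by apply: eq_bigr => i _; rewrite rmorphM /= pmeval_lin; have [_ ->] := hR i.
  by rewrite rmorphB /= eG -eb; ring.
have gl c : c *m L^T = 0 -> hideal (pts_line L) (lin c).
  move=> cL; apply: ideal_gen_mem; split; last exact: vanishes_on_line.
  by exists 1%N; exact: lin_homog.
apply: ideal_genD; last exact/ideal_genM/gl.
apply: ideal_gen_sum => i _; apply/ideal_genM/gl.
by rewrite -row_mul mulmx_ker row0.
Qed.

(** The linear forms vanishing on L have dimension n - 2 and pull back injectively into the
    multiples of h in S_n, of dimension e = n + 2 - [size h]. As [size h] is at least 4, both
    dimensions agree and all these multiples occur. *)
Lemma trisecant_cubic : exists g : {poly K}, [/\ size g = 4%N,
  forall c : 'rV[K]_n, c *m L^T = 0 -> g %| \sum_j c 0 j *: par j &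
  forall f, (size f <= m.+1)%N ->
    exists c : 'rV[K]_n, c *m L^T = 0 /\ \sum_j c 0 j *: par j = g * f].
Proof.
have [h [sh h0 hw]] := trisecant_gcd.
pose u i := w i %/ h; have wE i : w i = u i * h by rewrite divpK.
have wr i : rVpoly (row i (kermx L^T *m A)) = w i.
  by rewrite (row_mul i (kermx L^T)) /w sum_par.
pose e := (n.+2 - size h)%N.
have su i : (size (u i) <= e)%N.
  have [->|u0] := eqVneq (u i) 0; first by rewrite size_poly0.
  have : (size (w i) <= n.+1)%N by exact: size_sum_par.
  by rewrite wE size_mul // /e; move: (size (u i)) (size h) sh; clear; lia.
pose D := \matrix_i (poly_rV (u i) : 'rV[K]_e).
pose Mh := \matrix_(k < e) (poly_rV (h * 'X^k) : 'rV[K]_n.+1).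
have DE : kermx L^T *m A = D *m Mh.
  apply/row_matrixP => i; rewrite (row_mul i (kermx L^T)) (row_mul i D) rowK.
  rewrite -[LHS]rVpolyK -sum_par -[\sum_j _]/(w i) wE mulmx_sum_row.
  rewrite -[u i in LHS](@poly_rV_K _ e) // rVpoly_sum mulr_suml linear_sum.
  by apply: eq_bigr => k _; rewrite rowK -scalerAl linearZ /= [_ * h]mulrC.
have rK : \rank (kermx L^T) = (n - 2)%N.
  by rewrite mxrank_ker mxrank_tr; congr (_ - _)%N; apply/eqP.
have rD : (n - 2 <= \rank D)%N.
  by rewrite -rK -(mxrankMfree _ freeA) DE mxrankM_maxl.
have sh4 : size h = 4%N.
  have := leq_trans rD (rank_leq_col D); move: sh hm hn; rewrite /e.
  by move: (size h); clear; lia.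
have eE : e = (n - 2)%N by rewrite /e sh4; lia.
have fullD : row_full D by rewrite /row_full eqn_leq rank_leq_col {1}eE.
have hc (c : 'rV[K]_n) : c *m L^T = 0 -> h %| \sum_j c 0 j *: par j.
  move=> /sub_kermxP /submxP [y yE];
    rewrite sum_par yE -mulmxA mulmx_sum_row linear_sum.
  apply: dvdp_sum => i _; rewrite linearZ /= wr -mul_polyC.
  exact: dvdp_mull (hw i).
exists h; split=> // f sf.
have /submxP [y hy] := submx_full (poly_rV f : 'rV[K]_e) fullD.
exists (y *m kermx L^T); split; first by rewrite -mulmxA mulmx_ker mulmx0.
have fE : f = \sum_i y 0 i *: u i.
  rewrite -[LHS](@poly_rV_K _ e); last by rewrite (leq_trans sf) // eE; lia.
  by rewrite hy mulmx_sum_row linear_sum; apply: eq_bigr => i _;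
    rewrite linearZ rowK /= poly_rV_K.
rewrite (sum_par (y *m kermx L^T)) -mulmxA mulmx_sum_row linear_sum fE mulr_sumr.
by apply: eq_bigr => i _; rewrite linearZ /= wr wE -scalerAr [h * _]mulrC.
Qed.

End Trisecant.

(** * The polynomial E and the decomposition of V *)

Section Residue.
Variables (g : {poly K}).
Hypotheses (size_g : size g = 4%N).
Hypothesis pair_g : forall f, (size f <= m.+1)%N -> pairing (g * f) = 0.

(** Since g S_(n-3) lies in V, the pairing of E f depends only on f modulo g; hence E S_(n-2) lies
    in V and [pair_quadratic] applies. *)
Lemma pair_residue (E : {poly K}) : (size E <= 3)%N ->
  (forall f, (size f <= 3)%N -> pairing (E * f) = 0) -> E = 0.
Proof.
move=> sE hE; apply: pair_quadratic => // f sf.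
have g0 : g != 0 by rewrite -size_poly_eq0 size_g.
have hr : pairing (E * (f %% g)) = 0 by apply: hE; rewrite -ltnS -size_g ltn_modp.
rewrite (divp_eq f g) mulrDr linearD /= hr addr0.
rewrite mulrA mulrC pair_g // (leq_trans (size_polyMleq _ _)) // size_divp // size_g.
by move: (size E) (size f) sE sf hn hm; clear; lia.
Qed.

(** Two linear conditions on the three coefficients of E. *)
Lemma residue_dual : exists E : {poly K}, [/\ (size E <= 3)%N, pairing E = 0, pairing
  (E * 'X) = 0 & E != 0].
Proof.
pose B := \matrix_(i < 3, j < 2) p (i + j)%N.
have [b bB b0] : exists2 b : 'rV_3, (b <= kermx B)%MS & b != 0.
  apply/rowV0Pn; rewrite kermx_eq0 /row_free neq_ltn.
  by rewrite (leq_ltn_trans (rank_leq_col _)).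
have bp (j : 'I_2) : pairing (rVpoly b * 'X^j) = 0.
  move/sub_kermxP: bB => /matrixP /(_ 0 j); rewrite !mxE => <-.
  rewrite rVpoly_sum mulr_suml linear_sum; apply: eq_bigr => i _.
  rewrite -scalerAl linearZ /= -exprD pairX ?mxE //; last by have := ltn_ord i;
    have := ltn_ord j; lia.
exists (rVpoly b); split; first exact: size_poly.
- by have := bp ord0; rewrite mulr1.
- exact: (bp (lift ord0 ord0)).
- by apply: contraNneq b0 => e; rewrite -[b]rVpolyK e linear0.
Qed.

Section Dual.
Variables (E : {poly K}).
Hypotheses (size_E : (size E <= 3)%N) (E_n0 : E != 0).
Hypotheses (pair_E : pairing E = 0) (pair_EX : pairing (E * 'X) = 0).

Lemma pair_E_linear f : (size f <= 2)%N -> pairing (E * f) = 0.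
Proof.
move: f; apply: poly_lin_ind => [|f f' h h'|a f h|[|[|//]] _].
- by rewrite mulr0 linear0.
- by rewrite mulrDr linearD /= h h' addr0.
- by rewrite -scalerAr linearZ /= h scaler0.
- by rewrite mulr1.
- by [].
Qed.

(* If z were a common root then E would also be orthogonal to g / (X - z), hence to
   all of K[X] / g. *)
Lemma dual_coprime : coprimep g E.
Proof.
have g0 : g != 0 by rewrite -size_poly_eq0 size_g.
apply/negPn/negP => nc.
have [z rz] : exists z, root (gcdp g E) z by apply/closed_rootP.
rewrite root_gcd in rz; case/andP: rz => /factor_theorem [q gq] /factor_theorem [E1 EE].
have q0 : q != 0 by apply: contra_eq_neq gq => ->; rewrite mul0r.
have sq : size q = 3%N.
  have := size_g; rewrite gq size_mul ?polyXsubC_eq0 // size_XsubC addn2 /=.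
  by case.
have sE1 : (size E1 <= m.+1)%N.
  have [->|E10] := eqVneq E1 0; first by rewrite size_poly0.
  move: size_E; rewrite EE size_mul ?polyXsubC_eq0 // size_XsubC.
  by move: (size E1) hm; clear; lia.
case/eqP: E_n0; apply: pair_residue => // f sf.
have hr : pairing (E * (f %% q)) = 0 by apply: pair_E_linear;
  rewrite -ltnS -sq ltn_modp.
rewrite (divp_eq f q) mulrDr linearD /= hr addr0.
have -> : E * (f %/ q * q) = g * (E1 * (f %/ q)) by rewrite EE gq; ring.
rewrite pair_g // (leq_trans (size_polyMleq _ _)) // size_divp // sq.
by move: sE1 sf; move: (size E1) (size f); clear; lia.
Qed.

(** With a inverse to E modulo g, take for x the remainder of a f. Then E x is orthogonal to p,
    whereas E X^2 is not by [pair_residue], so x has no term in X^2. *)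
Lemma pair0_dec f : (size f <= n.+1)%N -> pairing f = 0 ->
  exists x y : {poly K}, [/\ (size x <= 2)%N, (size y <= m.+1)%N & f = E * x + g * y].
Proof.
move=> sf f0; have g0 : g != 0 by rewrite -size_poly_eq0 size_g.
have [[u1 u2] /= hu] := Bezoutp g E.
have [a aE] : exists a, g %| a * E - 1.
  have /eqP := dual_coprime; rewrite -(eqp_size hu) => /eqP /size_poly1P [c c0 hc].
  exists (c^-1 *: u2); apply/dvdpP; exists (- c^-1 *: u1).
  rewrite -scalerAl -scalerAl scaleNr; apply/eqP;
    rewrite subr_eq addrC -subr_eq opprK -scalerDr addrC hc.
  by rewrite -mul_polyC -polyCM mulVf.
pose x := (a * f) %% g.
have sx : (size x <= 3)%N by rewrite -ltnS -size_g ltn_modp.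
have /dvdpP [y hy] : g %| f - E * x.
  have -> : f - E * x = (E * ((a * f) %/ g)) * g - (a * E - 1) * f.
    rewrite {1}/x -[in RHS]mulrA; have := divp_eq (a * f) g; set d := _ %/ g;
      set r := _ %% g => e.
    have -> : (a * E - 1) * f = E * (a * f) - f by ring.
    by rewrite e; ring.
  by apply: dvdp_sub; [exact: dvdp_mulIr | exact: dvdp_mulr].
have fE : f = E * x + g * y by rewrite [g * y]mulrC -hy addrCA subrr addr0.
have sy : (size y <= m.+1)%N.
  have [->|y0] := eqVneq y 0; first by rewrite size_poly0.
  have : (size (y * g)%R <= n.+1)%N.
    rewrite -hy (leq_trans (size_polyD _ _)) // geq_max sf size_polyN.
    apply: leq_trans (size_polyMleq _ _) _; move: size_E sx hn hm.
    by move: (size E) (size x); clear; lia.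
  by rewrite size_mul // size_g; move: hn (size y); clear; lia.
exists x, y; split=> //.
have pEx : pairing (E * x) = 0 by have := f0; rewrite fE linearD /= pair_g // addr0.
have xE : x = x`_2 *: 'X^2 + \poly_(i < 2) x`_i.
  apply/polyP => i; rewrite coefD coefZ coefXn coef_poly.
  case: i => [|[|[|i]]] /=; rewrite ?mulr0 ?mulr1 ?add0r ?addr0 //.
  by rewrite nth_default // (leq_trans sx).
have x2 : x`_2 = 0.
  have hr : pairing (E * \poly_(i < 2) x`_i) = 0 by apply: pair_E_linear;
    exact: size_poly.
  move: pEx; rewrite {1}xE mulrDr linearD /= hr addr0.
  rewrite -scalerAr linearZ /= => e0;
    have : x`_2 * pairing (E * 'X^2) == 0 by apply/eqP.
  rewrite mulf_eq0 => /orP [/eqP //|/eqP e2].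
  case/eqP: E_n0; apply: pair_residue => //;
    apply: poly_lin_ind => [|h h' e e'|b h e|[|[|[|//]]] _].
  - by rewrite mulr0 linear0.
  - by rewrite mulrDr linearD /= e e' addr0.
  - by rewrite -scalerAr linearZ /= e scaler0.
  - by rewrite mulr1.
  - by [].
  - by [].
by rewrite xE x2 scale0r add0r size_poly.
Qed.

End Dual.
End Residue.


End Hyperplane.

(** * The curve and its trisecant line *)

Section FormsOnCurve.
Variables (K : closedFieldType) (n : nat).
Implicit Types (v : 'I_n -> {poly K}) (F : {mpoly K[n]}).

Lemma coefM_top (f h : {poly K}) i j : (size f <= i.+1)%N -> (size h <= j.+1)%N ->
  (f * h)`_(i + j) = f`_i * h`_j.
Proof.
move=> sf sh; have hi : (i < (i + j).+1)%N by lia.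
rewrite coefM (bigD1 (Ordinal hi)) //= addKn big1 ?addr0 // => k.
rewrite -val_eqE /= neq_ltn => /orP [ki|ik].
  by rewrite [h`__]nth_default ?mulr0 // (leq_trans sh) //; lia.
by rewrite [f`__]nth_default ?mul0r // (leq_trans sf).
Qed.

(** Top coefficients multiply, so this coefficient is the value of F at the point with infinite
    parameter. *)
Lemma coef_pmeval_top v e d F : (forall j, (size (v j) <= e.+1)%N) ->
  F \is d.-homog -> (pmeval v F)`_(e * d) = F.@[fun j => (v j)`_e].
Proof.
move=> sv hF; have := hF; move: d F hF.
pose P d F := F \is d.-homog -> (pmeval v F)`_(e * d) = F.@[fun j => (v j)`_e].
suff PP d F : F \is d.-homog -> F \is d.-homog /\ P d F by move=> d F /PP [].
move: d F; apply: dhomog_ind => [|d|d F G [hF IHF] [hG IHG]|d b F [hF IHF]|d j F [hF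
  IHF]]; rewrite /P.
- by rewrite dhomog1 rmorph1 meval1 muln0 coef1.
- by rewrite rpred0 rmorph0 meval0 coef0.
- by rewrite rpredD // rmorphD coefD mevalD IHF ?IHG.
- by rewrite rpredZ // pmevalZ coefZ mevalZ IHF.
- have hX : 'X_j * F \is d.+1.-homog by rewrite -add1n dhomogM // dhomogX /= mdeg1.
  by rewrite hX rmorphM /= pmevalX mulnS coefM_top ?size_pmeval // IHF // mevalM
    mevalXU.
Qed.

Lemma dvdp_pmevalB D v v' F : (forall j, D %| v j - v' j) ->
  D %| pmeval v F - pmeval v' F.
Proof.
move=> Dv; have DX d G : G \is d.-homog -> D %| pmeval v G - pmeval v' G.
  move: d G; apply: dhomog_ind => [|d|d {}F G IHF IHG|d b {}F IHF|d j {}F IHF].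
  - by rewrite !rmorph1 subrr dvdp0.
  - by rewrite !rmorph0 subrr dvdp0.
  - by rewrite !rmorphD opprD addrACA dvdp_add.
  - by rewrite !pmevalZ -scalerBr -mul_polyC dvdp_mull.
  - rewrite !rmorphM /= !pmevalX.
    have -> : v j * pmeval v F - v' j * pmeval v' F =
      v j * (pmeval v F - pmeval v' F) + pmeval v' F * (v j - v' j) by ring.
    by rewrite dvdp_add // dvdp_mull.
rewrite [F]mpolyE !rmorph_sum -sumrB; apply: dvdp_sum => m _ /=.
rewrite !pmevalZ -scalerBr -mul_polyC dvdp_mull //.
by apply: (DX (mdeg m)); rewrite dhomogX.
Qed.

End FormsOnCurve.

(** If c is nonzero, the Gram matrix has zeros above an antidiagonal c, -c, -c, c and is invertible;
    its rank 4 is at most that of S. *)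
Lemma antitriangular_gram (K : fieldType) n (S : 'M[K]_n) (x : 'I_4 -> 'rV[K]_n)
    (B := fun i j => (x i *m S *m (x j)^T) 0 0) (c : K) :
  (forall i j, B i j = B j i) -> B 0 0 = 0 -> B 0 1 = 0 -> B 0 2%:R = 0 -> B 1 1 = 0 ->
  B 0 3%:R = c -> B 1 2%:R = - c -> (\rank S <= 3)%N -> c = 0.
Proof.
move=> Bs b00 b01 b02 b11 b03 b12 rS; apply/eqP; apply: contraLR rS => c0.
pose N := \matrix_i x i; pose G := N *m S *m N^T.
have GE i j : G i j = B i j.
  have Nx k : x k = row k N by rewrite rowK.
  rewrite /B !Nx -row_mul /G !mxE; apply: eq_bigr => k _.
  by rewrite [RHS]/= !mxE.
have rG : (\rank G <= \rank S)%N.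
  by rewrite (leq_trans (mxrankM_maxl _ _)) // mxrankM_maxr.
rewrite -ltnNge (leq_trans _ rG) //.
suff : row_free G by move/eqP ->.
rewrite -kermx_eq0; apply/rowV0P => y /sub_kermxP yG.
have eqj j : y 0 0 * B 0 j + y 0 1 * B 1 j + y 0 2%:R * B 2%:R j + y 0 3%:R * B 3%:R j
  = 0.
  move/matrixP: yG => /(_ 0 j);
    rewrite !mxE !big_ord_recl big_ord0 addr0 !GE !addrA => <-.
  by congr (_ * B _ _ + _ * B _ _ + _ * B _ _ + _ * B _ _);
    exact/congr1/val_inj || exact/val_inj.
have nc : - c != 0 by rewrite oppr_eq0.
have y3 : y 0 3%:R = 0.
  have := eqj 0; rewrite b00 [B 1 0]Bs b01 [B 2%:R 0]Bs b02 [B 3%:R 0]Bs b03 !mulr0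
    !add0r.
  by move/eqP; rewrite mulf_eq0 (negPf c0) orbF => /eqP.
have y2 : y 0 2%:R = 0.
  have := eqj 1; rewrite b01 b11 [B 2%:R 1]Bs b12 y3 mul0r !mulr0 !add0r addr0.
  by move/eqP; rewrite mulf_eq0 (negPf nc) orbF => /eqP.
have y1 : y 0 1 = 0.
  have := eqj 2%:R; rewrite b02 b12 y2 y3 !mul0r mulr0 add0r !addr0.
  by move/eqP; rewrite mulf_eq0 (negPf nc) orbF => /eqP.
have y0 : y 0 0 = 0.
  have := eqj 3%:R; rewrite b03 y1 y2 y3 !mul0r !addr0.
  by move/eqP; rewrite mulf_eq0 (negPf c0) orbF => /eqP.
apply/rowP => -[[|[|[|[|//]]]] i4]; rewrite mxE.
- by rewrite -[RHS]y0; congr (y _ _); exact: val_inj.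
- by rewrite -[RHS]y1; congr (y _ _); exact: val_inj.
- by rewrite -[RHS]y2; congr (y _ _); exact: val_inj.
- by rewrite -[RHS]y3; congr (y _ _); exact: val_inj.
Qed.

(** * The curve and the line on the scroll, and their ideal *)

Section Config.
Variables (K : closedFieldType) (K2 : (2%:R : K) != 0) (n m : nat).
Hypotheses (hn : n = m.+3) (hm : (2 <= m)%N).
Variables (v : 'I_n -> {poly K}) (xi : {linear {poly K} -> 'rV[K]_n}).
Variables (E g : {poly K}) (C : 'rV[K]_n -> Prop) (L : 'M[K]_(2, n)).
Hypotheses (size_v : forall j, (size (v j) <= n.+1)%N).
Hypotheses (size_E : (size E <= 3)%N) (size_g : size g = 4%N).
Hypotheses (coprime_gE : coprimep g E) (freeL : row_free L).

Local Notation zeta := (zeta xi E g).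
Local Notation on_line := (on_line m xi E g).
Local Notation quadrics4 := (quadrics4 m v xi E g).
Local Notation base := (base E g).
Local Notation wpack := (wpack m xi E g).
Implicit Types (f h : {poly K}) (F G H : {mpoly K[n]}) (x y : 'rV[K]_n).

Hypothesis xiK : forall c h, (size h <= (cap m c).+1)%N ->
  \sum_j xi (base c * h) 0 j *: v j = base c * h.
Hypothesis var_dec : forall j : 'I_n, exists h h' : {poly K},
  [/\ (size h <= 2)%N, (size h' <= m.+1)%N & 'X_j = zeta false h + zeta true h'].
Hypothesis lineP : forall x, (x <= L)%MS <-> on_line x.

Definition vpt t : 'rV[K]_n := \row_j (v j).[t].
Definition vinf : 'rV[K]_n := \row_j (v j)`_n.

Hypothesis C_pt : forall t, vpt t != 0 -> C (vpt t).
Hypothesis C_cases : forall x, C x ->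
  x != 0 /\ exists a, (exists t, x = a *: vpt t) \/ x = a *: vinf.

Lemma zeta_vpt c h t : (size h <= (cap m c).+1)%N ->
  mevalv (zeta c h) (vpt t) = (base c * h).[t].
Proof.
move=> sh; rewrite -(xiK sh) horner_sum mevalv_lin mxE.
by apply: eq_bigr => j _; rewrite hornerZ !mxE mulrC.
Qed.

Lemma mevalv_vpt F t : mevalv F (vpt t) = (pmeval v F).[t].
Proof. by rewrite horner_pmeval; apply: meval_eq => j; rewrite mxE. Qed.

Lemma root_gE t : root g t -> E.[t] != 0.
Proof. by move=> gt; have := coprimep_root coprime_gE gt. Qed.

(** The forms u_1 and y_0 take the values g(t) and E(t), which are not both zero. *)
Lemma vpt_neq0 t : vpt t != 0.
Proof.
apply/eqP => v0; have z0 c h : (size h <= (cap m c).+1)%N -> (base c * h).[t] = 0.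
  by move=> sh; rewrite -zeta_vpt // v0 mevalv_lin mul0mx mxE.
have gt : root g t.
  by rewrite rootE -[g]mulr1; apply/eqP/(z0 true); rewrite size_poly1.
case/eqP: (root_gE gt).
by rewrite -[E]mulr1; apply: (z0 false); rewrite size_poly1.
Qed.

Lemma pmeval_vanishes d F : F \is d.-homog -> pmeval v F = 0 -> vanishes_on C F.
Proof.
move=> hF F0 x /C_cases [_ [a [[t ->]|->]]]; rewrite (mevalvZ _ _ hF).
  by rewrite mevalv_vpt F0 horner0 mulr0.
rewrite -[X in _ * X]/(meval _ _) (meval_eq (v2 := fun j => (v j)`_n)) => [|j].
  by rewrite -(coef_pmeval_top size_v hF) F0 coef0 mulr0.
by rewrite mxE.
Qed.

Lemma vanishes_pmeval d F : F \is d.-homog -> vanishes_on C F <-> pmeval v F = 0.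
Proof.
move=> hF; split=> [FC|F0]; last exact: (pmeval_vanishes hF F0).
apply: (@poly_root_eq0 _ _ [::]) => t _; rewrite -mevalv_vpt.
by apply: FC; apply: C_pt; exact: vpt_neq0.
Qed.

Lemma vanishes_line d F : F \is d.-homog -> vanishes_on (pts_line L) F ->
  forall x, on_line x -> mevalv F x = 0.
Proof.
move=> hF FL x /lineP xL; have [->|x0] := eqVneq x 0; last exact: FL.
(* The zero vector satisfies [on_line] but is no point of L. Written as 0 times a point of L, it is
   still a zero of F, even in degree 0. *)
have r0 : row 0 L != 0.
  apply/negP => /eqP r0; have := freeL;
    rewrite -kermx_eq0 => /rowV0P /(_ (delta_mx 0 0)).
  rewrite sub_kermx -rowE r0 eqxx => /(_ isT) /matrixP /(_ 0 0) /eqP.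
  by rewrite !mxE !eqxx oner_eq0.
by rewrite -(scale0r (row 0 L)) (mevalvZ _ _ hF) FL ?mulr0 //; split=> //;
  exact: row_sub.
Qed.

Lemma line_vanishes F : (forall x, on_line x -> mevalv F x = 0) -> vanishes_on
  (pts_line L) F.
Proof. by move=> h x [_ /lineP]; exact: h. Qed.

Lemma line_coord x : on_line x -> mevalv (zeta false 1) x = 0 ->
  mevalv (zeta false 'X) x = 0 -> x = 0.
Proof.
move=> Lx x0 x1; have z0 h : (size h <= 2)%N -> mevalv (zeta false h) x = 0.
  move: h; apply: poly_lin_ind => [|f f' e e'|a f e|[|[|//]] _].
  - by rewrite linear0 /mevalv meval0.
  - by rewrite linearD /mevalv mevalD -!/(mevalv _ x) e e' addr0.
  - by rewrite linearZ /mevalv mevalZ -!/(mevalv _ x) e mulr0.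
  - exact: x0.
  - exact: x1.
apply/rowP => j; rewrite mxE; have [h [h' [sh sh' e]]] := var_dec j.
rewrite -[LHS](mevalXU (fun i => x 0 i)) e mevalD.
by rewrite -!/(mevalv _ x) z0 // Lx ?addr0.
Qed.

(** By [line_coord], y_0 and y_1 restrict to coordinates on L; [N] is their matrix in the basis
    given by the rows of [L]. *)
Lemma line_pt t : exists x,
  [/\ on_line x, mevalv (zeta false 1) x = 1 & mevalv (zeta false 'X) x = t].
Proof.
pose N := L *m (\matrix_(j < 2) xi (base false * 'X^j))^T.
have NE (y : 'rV_2) j : (y *m N) 0 j = mevalv (zeta false 'X^j) (y *m L).
  rewrite /N mulmxA mevalv_lin !mxE; apply: eq_bigr => k _.
  by congr (_ * _); rewrite !mxE.
have cN (y : 'rV_2) : (y *m N) 0 0 = mevalv (zeta false 1) (y *m L) /\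
    (y *m N) 0 1 = mevalv (zeta false 'X) (y *m L) by rewrite !NE.
have uN : N \in unitmx.
  rewrite -row_free_unit -kermx_eq0; apply/rowV0P => y /sub_kermxP yN.
  have [e0 e1] := cN y; rewrite yN !mxE in e0 e1.
  have : y *m L = 0 by apply: line_coord => //; apply/lineP; exact: submxMl.
  move/eqP; rewrite -[y *m L]mul1mx => /eqP; rewrite mul1mx => yL.
  by apply/(row_free_inj freeL); rewrite yL mul0mx.
pose y := (\row_j (if j == 0 then 1 else t)) *m invmx N : 'rV_2.
have [e0 e1] := cN y; exists (y *m L); split.
- by apply/lineP; exact: submxMl.
- by rewrite -e0 /y mulmxKV // mxE.
- by rewrite -e1 /y mulmxKV // mxE.
Qed.

Local Notation IX := (hideal (pts_union C (pts_line L))).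

Lemma quadrics4_IX F : quadrics4 F -> is_form F /\ vanishes_on (pts_union C (pts_line
  L)) F.
Proof.
move=> [hF _ F0 FL]; split; first by exists 2%N.
move=> x [|]; first by move: x; apply/(vanishes_pmeval hF).
by move: x; exact: line_vanishes.
Qed.

Lemma IX_QR4 : QR 4 IX.
Proof.
have [z] : exists z, root g z by apply/closed_rootP; rewrite size_g.
move=> /factor_theorem [q gq]; rewrite mulrC in gq.
exists quadrics4; split=> [F []|F]; first by [].
split; apply: ideal_gen_sub => G; last by move=> /quadrics4_IX; exact: ideal_gen_mem.
move=> [[d hG] GV]; apply: (ideal_rank4 K2 hm size_E size_g gq coprime_gE xiK var_dec
  line_pt hG).
  by apply/(vanishes_pmeval hG) => x Cx; apply: GV; left.
by apply: (vanishes_line hG) => x Lx; apply: GV; right.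
Qed.

(** * The intersection of C and L, and the roots of g *)

Local Notation CL := (pts_inter C (pts_line L)).

Lemma on_line_vpt t : root g t -> on_line (vpt t).
Proof.
by move=> gt h sh; rewrite zeta_vpt // hornerM (eqP gt) mul0r.
Qed.

Lemma CL_vpt t : root g t -> CL (vpt t).
Proof.
move=> gt; split; first exact/C_pt/vpt_neq0.
by split; [exact: vpt_neq0 | exact/lineP/on_line_vpt].
Qed.

(** u_1 takes the value g(t) at [vpt t]. The infinite point is excluded: there u_(X^m) takes the
    leading coefficient of g as value, because n = m + 3. *)
Lemma CL_P x : CL x -> exists a t, [/\ a != 0, root g t & x = a *: vpt t].
Proof.
move=> [/C_cases [x0 [a xE]] [_ /lineP Lx]].
have a0 : a != 0 by apply: contraNneq x0 => a0; case: xE => [[t]|] ->;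
  rewrite a0 scale0r.
case: xE => [[t xE]|xE].
  exists a, t; split=> //; have := Lx 1; rewrite size_poly1 => /(_ isT) /eqP.
  rewrite xE (mevalvZ _ _ (lin_homog _)) mulf_eq0 (negPf a0) /= -/(zeta true 1).
  by rewrite zeta_vpt ?size_poly1 // mulr1.
have := Lx 'X^m; rewrite size_polyXn leqnn => /(_ isT) /eqP.
rewrite xE (mevalvZ _ _ (lin_homog _)) mulf_eq0 (negPf a0) /= => /eqP e.
have : (base true * 'X^m)`_n = 0.
  rewrite -(xiK (c := true)) ?size_polyXn // coef_sum -[RHS]e mevalv_lin mxE.
  by apply: eq_bigr => j _; rewrite coefZ !mxE mulrC.
have nm : (n < m)%N = false by move: hn; clear; lia.
have nm3 : (n - m = 3)%N by move: hn; clear; lia.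
rewrite coefMXn nm nm3.
have -> : g`_3 = lead_coef g by rewrite lead_coefE size_g.
by move/eqP; rewrite lead_coef_eq0 -size_poly_eq0 size_g.
Qed.

(** At [vpt t] the forms y_0 and y_1 have values E(t) and t E(t), and E(t) is nonzero at a root of
    g. *)
Lemma vpt_inj t t' : root g t -> (vpt t == vpt t')%MS -> t = t'.
Proof.
move=> gt /andP [/sub_rVP [a e] _].
have e0 h : (size h <= 2)%N -> (E * h).[t] = a * (E * h).[t'].
  move=> sh; rewrite -!(zeta_vpt (c := false)) // e.
  by rewrite (mevalvZ _ _ (lin_homog _)).
have := e0 1; rewrite size_poly1 mulr1 => /(_ isT) e1.
have := e0 'X; rewrite size_polyX !hornerMX => /(_ isT).
rewrite mulrA -e1 => /(mulfI (root_gE gt)).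
by [].
Qed.

Definition repeated := exists z, ('X - z%:P) ^+ 2 %| g.

Lemma repeated_two : repeated -> at_most_two_points CL.
Proof.
move=> [z /dvdpP [b gE]] u x w /CL_P [a1 [t1 [a10 r1 ->]]].
move=> /CL_P [a2 [t2 [a20 r2 ->]]] /CL_P [a3 [t3 [a30 r3 ->]]].
have b0 : b != 0 by apply: contra_eq_neq size_g; rewrite gE => ->;
  rewrite mul0r size_poly0.
have sb : size b = 2%N.
  have := size_g; rewrite gE size_Mmonic ?monic_exp ?monicXsubC // size_exp_XsubC.
  by move: (size b); clear; lia.
have rootb t : root g t -> t = z \/ root b t.
  rewrite gE rootM expr2 rootM orbb root_XsubC.
  by case/orP => [|/eqP ->]; [right | left].
have bb t t' : root b t -> root b t' -> t = t'.
  move=> bt bt'; apply/eqP; apply: contraT => tt'.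
  have := max_poly_roots b0 (rs := [:: t; t']); rewrite /= bt bt' inE tt' sb /=.
  by move=> /(_ isT isT).
have same a a' t : a != 0 -> a' != 0 -> (a *: vpt t == a' *: vpt t)%MS.
  by move=> a0 a'0; apply/eqmxP;
    apply: eqmx_trans (eqmx_scale _ a0) (eqmx_sym (eqmx_scale _ a'0)).
case: (rootb t1 r1) => [->|b1].
  case: (rootb t2 r2) => [->|b2]; first by rewrite same.
  case: (rootb t3 r3) => [->|b3]; first by rewrite same // orbT.
  by rewrite (bb t2 t3 b2 b3) same // !orbT.
case: (rootb t2 r2) => [->|b2]; last by rewrite (bb t1 t2 b1 b2) same.
case: (rootb t3 r3) => [->|b3]; first by rewrite same // !orbT.
by rewrite (bb t1 t3 b1 b3) same // orbT.
Qed.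

(** Split g into linear factors; two of the three points given by its roots coincide, and [vpt_inj]
    makes the two roots equal. *)
Lemma two_repeated : at_most_two_points CL -> repeated.
Proof.
move=> two; apply: NNPP => nrep.
have closed_fact f : (1 < size f)%N -> exists t q, f = ('X - t%:P) * q /\ size f =
  (size q).+1.
  move=> sf; have [t] : exists t, root f t.
    by apply/closed_rootP; move: sf; case: (size f) => [|[]].
  move=> /factor_theorem [q fE]; exists t, q; rewrite mulrC -fE; split=> //.
  rewrite fE size_Mmonic ?monicXsubC ?size_XsubC ?addn2 //.
  by apply: contraTneq sf; rewrite fE => ->; rewrite mul0r size_poly0.
have [|t1 [q1 [gE s1]]] := closed_fact g; first by rewrite size_g.
have [|t2 [q2 [q1E s2]]] := closed_fact q1; first by move: s1; rewrite size_g => -[<-].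
have [|t3 [q3 [q2E s3]]] := closed_fact q2; first by move: s1;
  rewrite size_g s2 => -[<-].
have g123 : g = ('X - t1%:P) * ('X - t2%:P) * ('X - t3%:P) * q3.
  by rewrite gE q1E q2E !mulrA.
have r1 : root g t1 by rewrite g123 !rootM root_XsubC eqxx.
have r2 : root g t2 by rewrite g123 !rootM !root_XsubC eqxx orbT.
have r3 : root g t3 by rewrite g123 !rootM !root_XsubC eqxx !orbT.
have := two _ _ _ (CL_vpt r1) (CL_vpt r2) (CL_vpt r3).
case/or3P => /vpt_inj e.
- apply: nrep; exists t1; have -> : g = ('X - t1%:P) ^+ 2 * (('X - t3%:P) * q3).
    by rewrite g123 -(e r1); ring.
  exact: dvdp_mulr.
- apply: nrep; exists t1; have -> : g = ('X - t1%:P) ^+ 2 * (('X - t2%:P) * q3).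
    by rewrite g123 -(e r1); ring.
  exact: dvdp_mulr.
- apply: nrep; exists t2; have -> : g = ('X - t2%:P) ^+ 2 * (('X - t1%:P) * q3).
    by rewrite g123 -(e r2); ring.
  exact: dvdp_mulr.
Qed.

Lemma hideal_curve F : hideal C F -> pmeval v F = 0.
Proof. by apply: ideal_gen_ker => G [[d hG] /(vanishes_pmeval hG)]. Qed.

Lemma hideal_line F x : hideal (pts_line L) F -> on_line x -> mevalv F x = 0.
Proof.
move=> hF Lx; apply: (ideal_gen_ker (f := meval (fun i => x 0 i)) _ hF).
by move=> G [[d hG] /(vanishes_line hG)]; exact.
Qed.

Lemma coprime_sqr z f : ~~ root f z -> coprimep (('X - z%:P) ^+ 2) f.
Proof. by move=> fz; rewrite coprimep_expl // coprimep_sym coprimep_XsubC. Qed.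

(* Reducing the parametrization modulo (X - z)^2 yields points of L, so the ideals of C
   and of L both pull back into the ideal of (X - z)^2. *)
Lemma repeated_mult : repeated -> exists q, CL q /\ mult_ge (inter_ideal C L) q 2.
Proof.
move=> [z Dg]; set D := _ ^+ 2 in Dg; have sD : size D = 3%N by rewrite size_exp_XsubC.
have gz : root g z.
  by rewrite -dvdp_XsubCl (dvdp_trans _ Dg) // dvdp_exp.
exists (vpt z); split; first exact: CL_vpt.
(* The germs are y_0 and y_1: their pullbacks E and E X are independent modulo (X - z)^2 because
   E(z) is nonzero. *)
exists 1%N, (fun i : 'I_2 => zeta false 'X^i); split=> [i|c]; first exact: lin_homog.
set F := \sum_i _; move=> [h [_ hz [G [H [GC HL hF]]]]].
pose w j := v j %% D.
have Lw t : on_line (\row_j (w j).[t]).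
  move=> f sf; rewrite mevalv_lin mxE.
  have -> : \sum_j (\row_j0 (w j0).[t]) 0 j * (xi (base true * f))^T j 0 = ((base true
    * f) %% D).[t].
    rewrite -{2}(xiK (c := true)) // (big_morph _ (modpD D) (mod0p D)) horner_sum.
    by apply: eq_bigr => j _; rewrite !mxE modpZl hornerZ mulrC.
  by rewrite (eqP (dvdp_mulr _ Dg : (base true * f) %% D == 0)) horner0.
have DvB F' : D %| pmeval v F' - pmeval w F'.
  by apply: dvdp_pmevalB => j; rewrite {1}(divp_eq (v j) D) addrK dvdp_mulIr.
have Dh : D %| pmeval v h * pmeval v F.
  rewrite -rmorphM hF rmorphD /= (hideal_curve GC) add0r.
  have wH : pmeval w H = 0.
    apply: (@poly_root_eq0 _ _ [::]) => t _;
      rewrite horner_pmeval -[RHS](hideal_line HL (Lw t)).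
    by apply: meval_eq => j; rewrite mxE.
  by rewrite -[pmeval v H]subr0 -wH.
have hz' : ~~ root (pmeval v h) z.
  rewrite rootE horner_pmeval; apply: contraNneq hz => <-.
  by apply/eqP/meval_eq => j; rewrite mxE.
rewrite Gauss_dvdpr ?coprime_sqr // in Dh.
have FE : pmeval v F = E * (\sum_(i < 2) c i *: 'X^i).
  rewrite rmorph_sum mulr_sumr; apply: eq_bigr => i _ /=.
  by rewrite pmevalZ (pmeval_zeta xiK) ?size_polyXn ?scalerAr //=.
rewrite FE Gauss_dvdpr ?coprime_sqr ?root_gE // in Dh.
have s0 : \sum_(i < 2) c i *: 'X^i = 0.
  apply/eqP; apply: contraT => n0; have := dvdp_leq n0 Dh; rewrite sD leqNgt ltnS.
  rewrite (_ : \sum_i _ = \poly_(i < 2) (if insub i is Some j then c j else 0))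
    ?size_poly //.
  by rewrite poly_def; apply: eq_bigr => i _; rewrite valK.
move=> i; have := congr1 (fun f : {poly K} => f`_i) s0; rewrite coef0 coef_sum => <-.
rewrite (bigD1 i) //= coefZ coefXn eqxx mulr1 big1 ?addr0 // => j.
by rewrite coefZ coefXn eq_sym => /negPf; rewrite -val_eqE /= => ->; rewrite mulr0.
Qed.

Lemma inter_idealD F G : inter_ideal C L F -> inter_ideal C L G -> inter_ideal C L (F +
  G).
Proof.
move=> [F1 [F2 [h1 h2 ->]]] [G1 [G2 [h3 h4 ->]]]; exists (F1 + G1), (F2 + G2).
by split; [exact: ideal_genD | exact: ideal_genD | ring].
Qed.

Lemma inter_idealM H F : inter_ideal C L F -> inter_ideal C L (H * F).
Proof.
move=> [F1 [F2 [h1 h2 ->]]]; exists (H * F1), (H * F2).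
by split; [exact: ideal_genM | exact: ideal_genM | ring].
Qed.

Lemma inter_ideal_curve d F : F \is d.-homog -> pmeval v F = 0 -> inter_ideal C L F.
Proof.
move=> hF F0; exists F, 0; split; [| exact: ideal_gen0 | by rewrite addr0].
by apply: ideal_gen_mem; split; [exists d | exact/(vanishes_pmeval hF)].
Qed.

Lemma inter_ideal_line d F : F \is d.-homog -> (forall x, on_line x -> mevalv F x = 0)
  ->
  inter_ideal C L F.
Proof.
move=> hF F0; exists 0, F; split; [exact: ideal_gen0 | | by rewrite add0r].
by apply: ideal_gen_mem; split; [exists d | exact: line_vanishes].
Qed.

Lemma inter_ideal_eqv F G : eqv m v xi E g F G -> inter_ideal C L G -> inter_ideal C L
  F.
Proof.
move=> FG hG; rewrite -[F](subrK G); apply: inter_idealD => //.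
exists (F - G), 0; split; [| exact: ideal_gen0 | by rewrite addr0].
apply: ideal_gen_sub FG => H [hH _ H0 _]; apply: ideal_gen_mem.
by split; [exists 2%N | exact/(vanishes_pmeval hH)].
Qed.

(* The cubic y0^3 g(y1 / y0) - y0^2 u_E vanishes on C: both terms pull back to E^3 g. *)
Lemma tangent_form t q : g = ('X - t%:P) * q ->
  inter_ideal C L (wpack 2 0 q * zeta false ('X - t%:P)).
Proof.
move=> gE; have sq : size q = 3%N by exact: size_q gE.
rewrite mulrC; apply: inter_ideal_eqv.
  by apply: (mul_wpack0 K2 hm size_E size_g coprime_gE xiK); rewrite ?size_XsubC // sq.
rewrite -gE; set u := zeta false 1 * (zeta false 1 * zeta true E).
have hu : u \is 3.-homog.
  by rewrite -[3%N]/(1 + (1 + 1))%N !dhomogM // lin_homog.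
have uL x : on_line x -> mevalv u x = 0.
  move=> Lx; rewrite !mevalvM [mevalv (zeta true E) x]Lx ?mulr0 //.
  by rewrite (leq_trans size_E).
rewrite -[wpack _ _ _](subrK u); apply: inter_idealD;
  last exact: inter_ideal_line hu uL.
apply: (@inter_ideal_curve 3).
  by rewrite rpredB // -[3%N]addn0 wpack_homog.
rewrite rmorphB /= (pmeval_wpack K2 hm size_E size_g coprime_gE xiK) ?size_g //.
rewrite !rmorphM /= !(pmeval_zeta xiK) ?size_poly1 ?(leq_trans size_E) //=.
by ring.
Qed.

(** At a simple root t of g, [tangent_form] puts y_1 - t y_0 in the local ideal, so every form
    vanishing at the point belongs to it and the multiplicity is 1. *)
Lemma mult_repeated : (exists q, CL q /\ mult_ge (inter_ideal C L) q 2) -> repeated.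
Proof.
move=> [x [/CL_P [a [t [a0 gt xE]]] [d [f [hf indf]]]]].
have /factor_theorem [q] := gt; rewrite mulrC => gE.
apply: NNPP => nrep; have qt : ~~ root q t.
  apply/negP => /factor_theorem [q' q'E]; apply: nrep; exists t.
  by apply/dvdpP; exists q'; rewrite gE q'E; ring.
have Lx : on_line x.
  by move=> h sh; rewrite xE (mevalvZ _ _ (lin_homog _)) [mevalv _ _](on_line_vpt gt)
    ?mulr0.
(* Some nontrivial combination F of the two germs vanishes at x. *)
pose B : 'M_(2, 1) := \matrix_(i, j) mevalv (f i) x.
have [c cB c0] : exists2 c : 'rV_2, (c <= kermx B)%MS & c != 0.
  apply/rowV0Pn; rewrite kermx_eq0 /row_free neq_ltn.
  by rewrite (leq_ltn_trans (rank_leq_col _)).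
case/negP: c0; apply/eqP/rowP => i; rewrite mxE; apply: (indf (fun i => c 0 i)) => {i}.
set F := \sum_i _; have hF : F \is d.-homog by apply: rpred_sum => i _; exact: rpredZ.
have Fx : mevalv F x = 0.
  move/sub_kermxP: cB => /matrixP /(_ 0 0); rewrite !mxE => <-.
  by rewrite mevalv_sum; apply: eq_bigr => i _; rewrite mxE -mevalZ.
have hw D k f' : wpack D k f' \is (D + k).-homog by exact: wpack_homog.
(* This denominator is the cofactor in [tangent_form]; it is a unit at x since q(t) and E(t) are
   nonzero. *)
exists (wpack 2 0 q); split.
- by exists 2%N; rewrite -[2%N]addn0 wpack_homog.
- rewrite xE (mevalvZ _ _ (hw 2%N 0%N q)) mevalv_vpt.
  rewrite (pmeval_wpack K2 hm size_E size_g coprime_gE xiK);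
    last by rewrite (size_q size_g gE).
  by rewrite !hornerM !horner_exp mulr1 !mulf_neq0 ?expf_neq0 ?root_gE.
have [h [sh Fh]] := packedP K2 hm size_E size_g coprime_gE xiK var_dec hF.
have sh0 := sh 0%N isT; rewrite subn0 addn0 in sh0.
have h0t : root (h 0%N) t.
  have : mevalv (F - \sum_(k < d.+1) wpack (d - k) k (h k)) x = 0.
    by apply: (ideal_gen_ker (f := meval (fun i => x 0 i))) Fh => G [_ _ _]; exact.
  rewrite /mevalv mevalB -!/(mevalv _ x) Fx sub0r mevalv_sum big_ord_recl subn0.
  rewrite [X in _ + X]big1 => [|i _]; last by rewrite lift0 wpack_line.
  rewrite addr0 xE (mevalvZ _ _ (hw d 0%N _)) mevalv_vpt.
  rewrite (pmeval_wpack K2 hm size_E size_g coprime_gE xiK) ?addn0 //.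
  rewrite !hornerM !horner_exp mulr1 => /eqP; rewrite oppr_eq0 !mulf_eq0 !expf_eq0.
  by rewrite (negPf a0) (negPf (root_gE gt)) !andbF.
have h0 : inter_ideal C L (wpack 2 0 q * wpack d 0 (h 0%N)).
  case/factor_theorem: h0t => f' h0E.
  have [f'0|f'0] := eqVneq f' 0.
    by rewrite h0E f'0 mul0r wpack0 mulr0; apply: (@inter_ideal_curve 0);
      rewrite ?rpred0 ?rmorph0.
  move: sh0; rewrite h0E size_Mmonic ?monicXsubC // size_XsubC addn2 /= ltnS => sf'.
  have d0 : (0 < d)%N by apply: leq_trans sf'; rewrite size_poly_gt0.
  have sf'' : (size f' <= (d.-1 + 0 * m).+1)%N by rewrite addn0 prednK.
  have sX : (size ('X - t%:P)%R <= 2)%N by rewrite size_XsubC.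
  have e := mul_wpack0 K2 hm size_E size_g coprime_gE xiK sX sf''.
  rewrite prednK // [_ * f']mulrC in e.
  apply: inter_ideal_eqv (eqvM _ (eqv_sym e)) _.
  by rewrite mulrA mulrC; apply/inter_idealM/tangent_form.
apply: inter_ideal_eqv (eqvM _ Fh) _.
rewrite big_ord_recl subn0 mulrDr; apply: inter_idealD => //.
rewrite mulr_sumr; elim/big_ind: _ => [|G H|i _]; [|exact: inter_idealD|].
  by apply: (@inter_ideal_curve 0); rewrite ?rpred0 ?rmorph0.
apply: inter_idealM; apply: (inter_ideal_line (d := (d - i.+1) + i.+1)).
  by rewrite lift0 wpack_homog.
by move=> y Ly; rewrite lift0 wpack_line.
Qed.

(** * Polar forms, Taylor coefficients and the lower bound on the rank *)

Definition polar F x y : K := (x *m sym_mx_of F *m y^T) 0 0.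

Lemma polarE F x y : polar F x y = \sum_i \sum_j x 0 i * sym_mx_of F i j * y 0 j.
Proof.
rewrite /polar mxE exchange_big; apply: eq_bigr => j _ /=.
by rewrite [_^T _ _]mxE [(x *m _) _ _]mxE mulr_suml.
Qed.

Lemma polarC F x y : polar F x y = polar F y x.
Proof.
rewrite !polarE exchange_big; apply: eq_bigr => j _; apply: eq_bigr => i _ /=.
by rewrite -[in LHS](sym_mx_of_tr F) [_^T _ _]mxE; ring.
Qed.

Lemma polar_linM (c c' : 'rV[K]_n) x y : polar (lin c * lin c') x y =
  2%:R^-1 * (mevalv (lin c) x * mevalv (lin c') y + mevalv (lin c') x * mevalv (lin c)
    y).
Proof.
have pr (b b' : 'rV[K]_n) : (x *m (b^T *m b') *m y^T) 0 0 = mevalv (lin b) x * mevalv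
  (lin b') y.
  rewrite mulmxA -mulmxA mxE big_ord1 !mevalv_lin; congr (_ * _).
  by rewrite !mxE; apply: eq_bigr => j _; rewrite !mxE mulrC.
have e (S : 'M[K]_n) : (x *m (2%:R^-1 *: S) *m y^T) 0 0 = 2%:R^-1 * (x *m S *m y^T) 0 0.
  by rewrite -scalemxAr -scalemxAl mxE.
rewrite /polar sym_mx_linM // e mulmxDr mulmxDl [X in _ * X]mxE.
by rewrite !pr.
Qed.

Lemma polar_line F x y : F \is 2.-homog -> (forall x, on_line x -> mevalv F x = 0) ->
  on_line x -> on_line y -> polar F x y = 0.
Proof.
move=> hF FL Lx Ly.
have Lxy : on_line (x + y) by apply/lineP; rewrite addmx_sub //; exact/lineP.
have pD a b c : polar F (a + b) c = polar F a c + polar F b c.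
  by rewrite /polar !mulmxDl mxE.
have P0 w : on_line w -> polar F w w = 0 by move=> /FL; rewrite mevalv_quadric.
have := P0 _ Lxy; rewrite pD ![polar F _ (x + y)]polarC !pD P0 // [polar F y y]P0 //.
rewrite [polar F y x]polarC add0r addr0 -mulr2n -mulr_natl => /eqP.
by rewrite mulf_eq0 (negPf K2) => /eqP.
Qed.

Section Taylor.
Variables (z : K) (a : nat) (g1 : {poly K}).
Hypotheses (gE : g = g1 * ('X - z%:P) ^+ a) (g1z : ~~ root g1 z).

Local Notation shift f := (f \Po ('X + z%:P)).

Definition taylor l : 'rV[K]_n := \row_j (shift (v j))`_l.

Lemma zeta_taylor c h l : (size h <= (cap m c).+1)%N ->
  mevalv (zeta c h) (taylor l) = (shift (base c * h))`_l.
Proof.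
move=> sh; rewrite -(xiK sh) linear_sum coef_sum mevalv_lin mxE.
by apply: eq_bigr => j _; rewrite linearZ coefZ !mxE mulrC.
Qed.

Lemma shift_X : shift ('X - z%:P) = 'X.
Proof. by rewrite comp_polyB comp_polyX comp_polyC addrK. Qed.

Lemma shift_g h : shift (g * h) = shift (g1 * h) * 'X^a.
Proof.
by rewrite gE mulrAC comp_polyM rmorphXn /= shift_X.
Qed.

(** u_h pulls back to g h, which vanishes to order at least a at z. *)
Lemma taylor_line l : (l < a)%N -> on_line (taylor l).
Proof. by move=> la h sh; rewrite zeta_taylor // shift_g coefMXn la. Qed.

(** The sum is the coefficient of X^k in F(v(X + z)). *)
Lemma polar_taylor F k : F \is 2.-homog -> pmeval v F = 0 ->
  \sum_(l < k.+1) polar F (taylor l) (taylor (k - l)) = 0.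
Proof.
move=> hF; rewrite pmeval_quadric // => /(congr1 (fun f => (shift f)`_k)).
rewrite comp_poly0 coef0 => e; rewrite -[RHS]e linear_sum coef_sum.
under eq_bigr => l _ do rewrite polarE.
rewrite exchange_big; apply: eq_bigr => i _ /=.
rewrite linear_sum coef_sum exchange_big; apply: eq_bigr => j _ /=.
rewrite linearZ coefZ /= comp_polyM coefM mulr_sumr; apply: eq_bigr => l _.
by rewrite !mxE; ring.
Qed.

Hypotheses (a2 : (2 <= a)%N) (a3 : (a <= 3)%N).

(** With B the polar form, B(v_l, v_l') = 0 for l, l' < a. The coefficients of X^a and X^(a+1) then
    give B(v_0, v_a) = 0 and B(v_1, v_a) = - B(v_0, v_(a+1)), the input of [antitriangular_gram]. *)
Lemma polar_taylor0 F : F \is 2.-homog -> pmeval v F = 0 ->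
    (forall x, on_line x -> mevalv F x = 0) -> (quad_rank F <= 3)%N ->
  polar F (taylor 0) (taylor a.+1) = 0.
Proof.
move=> hF F0 FL rF.
have pl l l' : (l < a)%N -> (l' < a)%N -> polar F (taylor l) (taylor l') = 0.
  by move=> la la'; apply: polar_line => //; exact: taylor_line.
have half (y : K) : y + y = 0 -> y = 0.
  by rewrite -mulr2n -mulr_natl => /eqP; rewrite mulf_eq0 (negPf K2) => /eqP.
have p0a : polar F (taylor 0) (taylor a) = 0.
  apply: half; have := polar_taylor a hF F0; move: pl.
  have [-> | ->] : a = 2%N \/ a = 3%N by move: a2 a3; clear; lia.
    move=> pl; rewrite !big_ord_recr big_ord0 /= add0r subn0 subnn !subSS subn0.
    by rewrite [X in _ + X + _]pl // addr0 [X in _ + X]polarC.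
  move=> pl; rewrite !big_ord_recr big_ord0 /= add0r subn0 subnn !subSS !subn0.
  by rewrite [X in _ + X + _ + _]pl // [X in _ + X + _]pl // !addr0 [X in _ + X]polarC.
have p1a : polar F (taylor 0) (taylor a.+1) + polar F (taylor 1) (taylor a) = 0.
  apply: half; have := polar_taylor a.+1 hF F0; move: pl.
  have [-> | ->] : a = 2%N \/ a = 3%N by move: a2 a3; clear; lia.
    move=> pl; rewrite !big_ord_recr big_ord0 /= add0r subn0 subnn !subSS !subn0.
    by rewrite [polar F (taylor 2) _]polarC [polar F (taylor 3) _]polarC => <-; ring.
  move=> pl; rewrite !big_ord_recr big_ord0 /= add0r subn0 subnn !subSS !subn0.
  rewrite [X in _ + _ + X + _ + _]pl //.
  by rewrite [polar F (taylor 3) _]polarC [polar F (taylor 4) _]polarC => <-; ring.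
pose x (i : 'I_4) := nth 0 [:: taylor 0; taylor 1; taylor a; taylor a.+1] i.
apply: (@antitriangular_gram _ _ (sym_mx_of F) x) => //.
- by move=> i j; exact: polarC.
- exact: pl (ltnW a2) (ltnW a2).
- exact: pl (ltnW a2) a2.
- exact: pl.
- by apply/eqP; rewrite -addr_eq0 addrC; apply/eqP; exact: p1a.
Qed.

(** At v_0 all u_h vanish, and so does y_1 - z y_0. Only half of y_0(v_0) u_(X-z)(v_(a+1)) = E(z)
    g1(z) survives. *)
Lemma scroll_minor_polar :
  polar (zeta false 1 * zeta true ('X - z%:P) - zeta false ('X - z%:P) * zeta true 1)
    (taylor 0) (taylor a.+1) != 0.
Proof.
have s1 : (size (1%R : {poly K}) <= m.+1)%N by rewrite size_poly1.
have s2 : (size ('X - z%:P)%R <= m.+1)%N by rewrite size_XsubC ltnS ltnW.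
have val h : (size h <= m.+1)%N -> mevalv (zeta true h) (taylor 0) = 0.
  by move=> sh; apply: taylor_line; first exact: ltnW.
have vX : mevalv (zeta false ('X - z%:P)) (taylor 0) = 0.
  rewrite zeta_taylor ?size_XsubC //= comp_polyM shift_X coefMX //.
have vg : mevalv (zeta true ('X - z%:P)) (taylor a.+1) = g1.[z].
  rewrite zeta_taylor //= shift_g coefMXn ltnNge leqnSn /= subSnn comp_polyM shift_X
    coefMX /=.
  by rewrite -horner_coef0 horner_comp hornerD hornerX hornerC add0r.
have vE : mevalv (zeta false 1) (taylor 0) = E.[z].
  rewrite zeta_taylor ?size_poly1 //= mulr1.
  by rewrite -horner_coef0 horner_comp hornerD hornerX hornerC add0r.
have gz : root g z.
  by rewrite gE rootM -(prednK (ltnW a2)) exprS rootM root_XsubC eqxx orbT.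
rewrite /polar linearB mulmxBr mulmxBl mxE [X in _ + X]mxE -!/(polar _ _ _) !polar_linM.
rewrite vX vE vg !val // !mul0r !addr0 mulr0 subr0 !mulf_neq0 ?invr_neq0 //.
by rewrite root_gE.
Qed.

End Taylor.

(** By [sym_mx_ofM] the matrix of the minor is a combination of matrices of generators. Generators
    of rank at most 3 have polar form zero at (v_0, v_(a+1)), while the minor does not. *)
Lemma repeated_not_QR3 k : repeated -> QR k IX -> (4 <= k)%N.
Proof.
move=> [z Dg] [G [G4 GI]]; rewrite leqNgt; apply/negP => k3.
have g0 : g != 0 by rewrite -size_poly_eq0 size_g.
have [a [g1 g1z gE]] := multiplicity_XsubC g z; rewrite g0 /= in g1z.
have a2 : (2 <= a)%N.
  have : ('X - z%:P) ^+ 2 %| ('X - z%:P) ^+ a.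
    by rewrite -(Gauss_dvdpr _ (coprime_sqr g1z)) -gE.
  move=> dv; have := dvdp_leq _ dv; rewrite !size_exp_XsubC ltnS; apply.
  by rewrite expf_neq0 // polyXsubC_eq0.
have a3 : (a <= 3)%N.
  have g10 : g1 != 0 by apply: contraNneq g0 => e; rewrite gE e mul0r.
  have := size_g; rewrite gE size_Mmonic ?monic_exp ?monicXsubC // size_exp_XsubC.
  by move: g10; rewrite -size_poly_gt0; move: (size g1); clear; lia.
set Q := zeta false 1 * zeta true ('X - z%:P) - zeta false ('X - z%:P) * zeta true 1.
have s1 : (size (1%R : {poly K}) <= m.+1)%N by rewrite size_poly1.
have s2 : (size ('X - z%:P)%R <= m.+1)%N by rewrite size_XsubC ltnS ltnW.
have Q0 : pmeval v Q = 0.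
  rewrite rmorphB !rmorphM /= !(pmeval_zeta xiK) ?size_poly1 ?s2 ?size_XsubC //=.
  by ring.
have QL x : on_line x -> mevalv Q x = 0.
  by move=> Lx; rewrite /mevalv mevalB -!/(mevalv _ x) !mevalvM !Lx // !mulr0 subrr.
have : ideal_gen G Q.
  apply/GI; apply: ideal_gen_mem; apply: quadrics4_IX.
  by move: Q0 QL; rewrite /Q -[- (_ * _)]scaleN1r; exact: quadrics4I.
case=> s [sG QE]; have := scroll_minor_polar gE g1z a2; rewrite -/Q => /eqP; apply.
rewrite QE /polar linear_sum mulmx_sumr mulmx_suml summxE big_seq big1 // => x /sG Gx
  /=.
have [hx rx] := G4 _ Gx.
rewrite /= sym_mx_ofM // -scalemxAr -scalemxAl mxE.
have [x0 xL] : pmeval v x.2 = 0 /\ (forall y, on_line y -> mevalv x.2 y = 0).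
  have /GI hIx : ideal_gen G x.2 by exact: ideal_gen_mem.
  split.
    apply: (ideal_gen_ker _ hIx) => H [[d hH] HV].
    by apply/(vanishes_pmeval hH) => y Cy; apply: HV; left.
  move=> y Ly; apply: (ideal_gen_ker (f := meval (fun i => y 0 i)) _ hIx) => H [[d hH]
    HV].
  by apply: (vanishes_line hH) Ly => y' Cy; apply: HV; right.
rewrite -[X in _ * X]/(polar x.2 (taylor z 0) (taylor z a.+1)).
by rewrite (polar_taylor0 gE a2 a3) ?mulr0 // (leq_trans rx).
Qed.

Lemma config_theorem :
  (exists k : nat, is_rank_index IX k /\ (k <= 4)%N) /\
  ((at_most_two_points CL <-> exists q, CL q /\ mult_ge (inter_ideal C L) q 2) /\
   (at_most_two_points CL -> is_rank_index IX 4)).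
Proof.
split; [|split].
(* The least index comes from strong induction and excluded middle. *)
- have least k : QR k IX -> exists j, is_rank_index IX j /\ (j <= k)%N.
    elim/ltn_ind: k => k IHk Qk.
    case: (classic (exists2 j, (j < k)%N & QR j IX)) => [[j jk /(IHk j jk) [i [hi
      ij]]]|nk].
      by exists i; split=> //; apply: leq_trans ij (ltnW jk).
    exists k; split=> //; split=> // j Qj; rewrite leqNgt; apply/negP => jk; apply: nk.
    by exists j.
  exact/least/IX_QR4.
- by split=> [/two_repeated/repeated_mult|/mult_repeated/repeated_two].
- move=> /two_repeated rep; split; first exact: IX_QR4.
  by move=> j; exact: repeated_not_QR3.
Qed.

End Config.

(** Builds the data of the scroll: g from the line, then E from g, and the section [xi] from the
    matrix [A]. *)
Lemma param_theorem (K : closedFieldType) (K2 : (2%:R : K) != 0) (n m : nat)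
    (hn : n = m.+3) (hm : (2 <= m)%N) (A : 'M[K]_(n, n.+1)) (p : nat -> K)
    (freeA : row_free A) (nq : no_quadratic n p)
    (pairA : forall f : {poly K}, (size f <= n.+1)%N -> pairing n p f = 0 <-> (poly_rV
      f <= A)%MS)
    (C : 'rV[K]_n -> Prop) (L : 'M[K]_(2, n)) (c0 : 'rV[K]_n)
    (hL : trisecant_line C L) (c0L : c0 *m L^T = 0)
    (size_c0 : size (\sum_j c0 0 j *: par A j) = n.+1)
    (C_pt : forall t, vpt (par A) t != 0 -> C (vpt (par A) t))
    (C_cases : forall x, C x -> x != 0 /\
       exists a, (exists t, x = a *: vpt (par A) t) \/ x = a *: vinf (par A)) :
  let CL := pts_inter C (pts_line L) in
  let IX := hideal (pts_union C (pts_line L)) in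
  (exists k : nat, is_rank_index IX k /\ (k <= 4)%N) /\
  ((at_most_two_points CL <-> exists q, CL q /\ mult_ge (inter_ideal C L) q 2) /\
   (at_most_two_points CL -> is_rank_index IX 4)).
Proof.
move=> CL IX; have [freeL lenCL] := hL.
have C_par d F : F \is d.-homog -> pmeval (par A) F = 0 -> vanishes_on C F.
  exact: (pmeval_vanishes (size_par A) C_cases).
have [g [sg gdvd gex]] := trisecant_cubic K2 hn hm freeA nq pairA freeL lenCL C_par c0L
  size_c0.
have pair_g (f : {poly K}) : (size f <= m.+1)%N -> pairing n p (g * f) = 0.
  by move=> /gex [c [_ <-]]; exact: (pair_sum_par pairA).
have [E [sE pE pEX E0]] := residue_dual K2 hn hm p freeA sg.
have cop := dual_coprime K2 hn hm freeA nq sg pair_g sE E0 pE pEX.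
have xiKK c (h : {poly K}) : (size h <= (cap m c).+1)%N ->
    \sum_j xi A (base E g c * h) 0 j *: par A j = base E g c * h.
  move=> sh; apply: (xiK pairA); last first.
    by case: c sh => sh; [exact: pair_g | exact: (pair_E_linear pE pEX)].
  apply: leq_trans (size_polyMleq _ _) _; case: c sh => /=; rewrite ?sg.
    by move: (size h) hn; clear; lia.
  by move: (size h) (size E) sE hn; clear; lia.
have xi_sum (c : 'rV[K]_n) : xi A (\sum_j c 0 j *: par A j) = c by exact: xi_par.
apply: (@config_theorem K K2 n m hn hm (par A) (xi A) E g C L) => //.
- exact: size_par.
- move=> j; have [x [y [sx sy e]]] := pair0_dec K2 hn hm freeA nq sg pair_g sE E0 pE pEX
    (size_par A j) (pair_par pairA j).
  exists x, y; split=> //; rewrite /zeta -linearD -linearD /= -e -[par A j]scale1r.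
  rewrite -(lin_delta K j); congr lin; rewrite -[LHS](xi_sum (delta_mx 0 j));
    congr (xi A _).
  rewrite (bigD1 j) //= big1 => [|i ij]; first by rewrite mxE !eqxx addr0.
  by rewrite mxE (negPf ij) andbF scale0r.
move=> x; split=> [xL h sh|Lx].
  have [c [cL cE]] := gex h sh; rewrite /zeta /= -cE xi_sum mevalv_lin.
  case/submxP: xL => y ->; rewrite -mulmxA.
  have -> : L *m c^T = 0 by rewrite -[LHS]trmxK trmx_mul trmxK cL trmx0.
  by rewrite mulmx0 mxE.
rewrite submxE; apply/eqP/rowP => j; rewrite mxE [RHS]mxE.
(* The columns of [cokermx L] are equations of L; each pulls back to a multiple g f, hence is
   u_f. *)
pose c := (col j (cokermx L))^T.
have cL : c *m L^T = 0.
  by rewrite /c -trmx_mul colE mulmxA mulmx_coker mul0mx trmx0.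
have /dvdpP [f fE] := gdvd c cL; rewrite mulrC in fE.
have sf : (size f <= m.+1)%N.
  have [->|f0] := eqVneq f 0; first by rewrite size_poly0.
  have g0 : g != 0 by rewrite -size_poly_eq0 sg.
  have := size_sum_par A c; rewrite fE size_mul // sg.
  by move: (size f) hn; clear; lia.
have := Lx f sf; rewrite /zeta /= -fE xi_sum mevalv_lin mxE => e.
by rewrite -[RHS]e; apply: eq_bigr => k _; rewrite !mxE.
Qed.

(** * Points of the second secant variety *)

Section RationalNormalCurve.
Variables (K : closedFieldType).
Implicit Types (n : nat) (f : {poly K}) (s t : K).

Local Notation nu n := (@rnc_vec K n).

(* Value at (s, t) of the binary form of degree n with dehomogenization f. *)
Definition homev n f s t := \sum_(i < n.+1) s ^+ (n - i) * t ^+ i * f`_i.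

Lemma homev_linear n a b f s t : (size f <= n.+1)%N ->
  homev n.+1 ((a *: 'X + b%:P) * f) s t = (a * t + b * s) * homev n f s t.
Proof.
move=> sf; rewrite /homev [(_ * t + _) * _]mulrDl !mulr_sumr [(_ + _) * f]mulrDl.
under eq_bigr do rewrite coefD mulrDr.
rewrite big_split /=; congr (_ + _).
  rewrite big_ord_recl /= -scalerAl coefZ coefXM mulr0 mulr0 add0r.
  by apply: eq_bigr => i _; rewrite /bump add1n subSS coefZ coefXM /= exprS; ring.
rewrite big_ord_recr /= coefCM [f`_n.+1]nth_default // !mulr0 addr0.
by apply: eq_bigr => i _; rewrite coefCM subSn -1?ltnS // exprS; ring.
Qed.

Lemma size_linear (a b : K) : (size (a *: 'X + b%:P)%R <= 2)%N.
Proof.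
rewrite (leq_trans (size_polyD _ _)) // geq_max size_polyC (leq_trans (size_scale_leq _
  _)) ?size_polyX //.
by case: (b == 0).
Qed.

Lemma size_linear_exp k (a b : K) : (size ((a *: 'X + b%:P) ^+ k)%R <= k.+1)%N.
Proof.
apply: leq_trans (size_poly_exp_leq _ _) _; rewrite ltnS -{2}[k]mul1n leq_mul2r.
by rewrite -subn1 leq_subLR size_linear orbT.
Qed.

Lemma homev_exp k l a b c d s t :
  homev (k + l) ((a *: 'X + b%:P) ^+ k * (c *: 'X + d%:P) ^+ l) s t =
  (a * t + b * s) ^+ k * (c * t + d * s) ^+ l.
Proof.
elim: k => [|k IHk].
  rewrite mul1r mul1r; elim: l => [|l IHl].
    by rewrite /homev big_ord1 !expr0 coef1 !mulr1.
  by rewrite !exprS homev_linear ?IHl // size_linear_exp.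
rewrite addSn !exprS -!mulrA homev_linear ?IHk //.
apply: leq_trans (size_polyMleq _ _) _.
move: (size_linear_exp k a b) (size_linear_exp l c d).
by move: (size _) (size _); clear; lia.
Qed.

Lemma nu_form n f s t : (nu n s t *m \col_i f`_i) 0 0 = homev n f s t.
Proof. by rewrite mxE; apply: eq_bigr => i _; rewrite !mxE. Qed.

(** The substitution (s, t) -> (t, s + t0 t) on binary forms of degree n: column j dehomogenizes
    t^(n-j) (s + t0 t)^j. It places the parameter [1 : t0] at infinity. *)
Definition moebius n (t0 : K) : 'M[K]_n.+1 :=
  \matrix_(k, j) ('X ^+ (n - j) * (t0 *: 'X + 1) ^+ j)`_k.

Lemma nu_moebius n t0 s t : nu n s t *m moebius n t0 = nu n t (s + t0 * t).
Proof.
apply/rowP => j; have jn : (j <= n)%N by rewrite -ltnS.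
transitivity (homev n ('X ^+ (n - j) * (t0 *: 'X + 1) ^+ j) s t).
  by rewrite mxE; apply: eq_bigr => i _; rewrite !mxE.
have := homev_exp (n - j) j 1 0 t0 1 s t.
rewrite subnK // scale1r polyC0 addr0 polyC1 => ->.
by rewrite mxE !mul1r mul0r addr0 [s + _]addrC.
Qed.

Lemma nu_scale n s t : s != 0 -> nu n s t = s ^+ n *: nu n 1 (t / s).
Proof.
move=> s0; apply/rowP => i; rewrite !mxE expr1n mul1r expr_div_n.
have -> : s ^+ n = s ^+ (n - i) * s ^+ i by rewrite -exprD subnK // -ltnS.
by field; rewrite expf_neq0.
Qed.

Lemma nu_0 n t : nu n 0 t = t ^+ n *: nu n 0 1.
Proof.
apply/rowP => i; rewrite !mxE expr1n mulr1.
have [->|ni] := eqVneq (i : nat) n; first by rewrite subnn !expr0 mulr1 mul1r.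
by rewrite expr0n subn_eq0 leqNgt ltn_neqAle ni -ltnS ltn_ord /= !mul0r mulr0.
Qed.

Lemma nu_poly n (x : 'rV[K]_n.+1) t : (nu n 1 t *m x^T) 0 0 = (rVpoly x).[t].
Proof.
rewrite rVpoly_sum horner_sum mxE; apply: eq_bigr => i _.
by rewrite !mxE hornerZ hornerXn expr1n mul1r mulrC.
Qed.

Lemma nu_01 n (i : 'I_n.+1) : nu n 0 1 0 i = (i == n :> nat)%:R.
Proof.
rewrite mxE expr1n mulr1; have [->|ni] := eqVneq (i : nat) n; first by rewrite subnn.
by rewrite expr0n subn_eq0 leqNgt ltn_neqAle ni -ltnS ltn_ord.
Qed.

Lemma nu_coef n (x : 'rV[K]_n.+1) : (nu n 0 1 *m x^T) 0 0 = (rVpoly x)`_n.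
Proof.
rewrite mxE -[n in RHS]/(nat_of_ord (@ord_max n)) coef_rVpoly_ord (bigD1 ord_max) //=.
rewrite nu_01 eqxx mul1r mxE big1 ?addr0 // => i /negPf.
by rewrite -val_eqE nu_01 /= => ->; rewrite mul0r.
Qed.

(** The image contains all points [nu n 1 t], and a vector orthogonal to them is a polynomial
    vanishing everywhere. *)
Lemma moebius_unit n t0 : moebius n t0 \in unitmx.
Proof.
rewrite -unitmx_tr -row_free_unit -kermx_eq0; apply/rowV0P => x /sub_kermxP xS.
suff x0 : rVpoly x = 0 by rewrite -[x]rVpolyK x0 linear0.
apply: (@poly_root_eq0 _ _ [::]) => t _; rewrite -nu_poly.
have -> : nu n 1 t = nu n (t - t0) 1 *m moebius n t0 by rewrite nu_moebius mulr1 subrK.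
by rewrite -mulmxA -[moebius _ _]trmxK -trmx_mul xS trmx0 mulmx0 mxE.
Qed.

(* Limits along polynomial curves are enough to reach the tangent lines. *)
Definition secant_limit n (q : 'rV[K]_n.+1) := exists c : 'I_n.+1 -> {poly K},
  (forall i, (c i).[0] = q 0 i) /\
  forall e, e != 0 -> exists s t s' t' a b, s * t' - s' * t != 0 /\
    \row_i (c i).[e] = a *: nu n s t + b *: nu n s' t'.

(** Pairing with the n-th power of the linear form vanishing at one of the two parameters isolates
    the coefficient of the other. *)
Lemma nu_free n s t s' t' a b : (0 < n)%N -> s * t' - s' * t != 0 ->
  a *: nu n s t + b *: nu n s' t' = 0 -> a = 0 /\ b = 0.
Proof.
move=> n0 d0 e.
have val x y : a * (x * t + y * s) ^+ n + b * (x * t' + y * s') ^+ n = 0.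
  have := congr1 (fun z => (z *m \col_i ((x *: 'X + y%:P) ^+ n)`_i) 0 0) e.
  rewrite mul0mx mulmxDl -!scalemxAl 2!mxE [X in _ + X]mxE [RHS]mxE !nu_form.
  by have := homev_exp n 0 x y 0 0; rewrite addn0 => h; move: (h s t) (h s' t');
    rewrite !mulr1 => -> ->.
split.
  have := val s' (- t'); have -> : s' * t' + - t' * s' = 0 by ring.
  rewrite expr0n eqn0Ngt n0 mulr0 addr0 => /eqP; rewrite mulf_eq0 expf_eq0.
  have -> : s' * t + - t' * s = - (s * t' - s' * t) by ring.
  by rewrite oppr_eq0 (negPf d0) andbF orbF => /eqP.
have := val s (- t); have -> : s * t + - t * s = 0 by ring.
rewrite expr0n eqn0Ngt n0 mulr0 add0r => /eqP; rewrite mulf_eq0 expf_eq0.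
have -> : s * t' + - t * s' = s * t' - s' * t by ring.
by rewrite (negPf d0) andbF orbF => /eqP.
Qed.

Lemma rnc_nu n s t : (s != 0) || (t != 0) -> rnc (nu n s t).
Proof. by move=> st; exists s, t; split=> //; rewrite submx_refl. Qed.

(** A form vanishing on the secants pulls back to a polynomial in e that is zero for e nonzero,
    hence also at e = 0. *)
Lemma secant_limit_join n (q : 'rV[K]_n.+1) : (0 < n)%N -> q != 0 -> secant_limit q ->
  self_join (@rnc K n) 2 q.
Proof.
move=> n0 q0 [c [c0 cs]]; split=> // f hf fV.
have [i0 qi0] : exists i, q 0 i != 0.
  apply/existsP; rewrite -negb_forall; apply: contra q0 => /forallP h.
  by apply/eqP/rowP => i; rewrite mxE; apply/eqP.
have ci0 : c i0 != 0 by apply: contraNneq qi0 => e; rewrite -c0 e horner0.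
suff F0 : pmeval c f = 0.
  have := horner_pmeval c f 0; rewrite F0 horner0 => e; rewrite [RHS]e.
  by apply: meval_eq => i; rewrite c0.
(* The factor [c i0] disposes of parameters at which the curve [c] meets the zero vector, which is
   no projective point. *)
have : pmeval c f * c i0 = 0.
  apply: (@poly_root_eq0 _ _ [:: 0]) => e;
    rewrite inE => /cs [s [t [s' [t' [a [b [d0 ce]]]]]]].
  rewrite hornerM horner_pmeval; have [->|ci] := eqVneq (c i0).[e] 0;
    first by rewrite mulr0.
  have -> : f.@[fun j => (c j).[e]] = mevalv f (\row_i (c i).[e]).
    by apply: meval_eq => j; rewrite mxE.
  rewrite fV ?mul0r //; split.
    by apply: contraNneq ci => /rowP /(_ i0); rewrite !mxE => ->.
  pose P := \matrix_(i < 2) (if i == 0 then nu n s t else nu n s' t').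
  have Pr (y : 'rV_2) : y *m P = y 0 0 *: nu n s t + y 0 1 *: nu n s' t'.
    by rewrite mulmx_sum_row !big_ord_recl big_ord0 addr0 !rowK /=;
      congr (_ + y _ _ *: _); exact: val_inj.
  exists P; split.
  - move=> i; rewrite rowK; case: ifP => _; apply: rnc_nu; apply: contraNT d0;
    rewrite negb_or !negbK.
      by move=> /andP [/eqP -> /eqP ->]; rewrite mul0r mulr0 subrr.
    by move=> /andP [/eqP -> /eqP ->]; rewrite mul0r mulr0 subrr.
  - rewrite -kermx_eq0; apply/rowV0P => y /sub_kermxP;
    rewrite Pr => /(nu_free n0 d0) [y0 y1].
    apply/rowP => -[[|[|//]] i2]; rewrite mxE.
      by rewrite -[RHS]y0; congr (y _ _); exact: val_inj.
    by rewrite -[RHS]y1; congr (y _ _); exact: val_inj.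
  - apply/submxP; exists (\row_i (if i == 0 then a else b)).
    by rewrite Pr !mxE.
by move/eqP; rewrite mulf_eq0 (negPf ci0) orbF => /eqP.
Qed.

Lemma secant_limit_moebius n t0 (q : 'rV[K]_n.+1) :
  secant_limit q -> secant_limit (q *m moebius n t0).
Proof.
move=> [c [c0 cs]]; exists (fun j => \sum_i moebius n t0 i j *: c i); split=> [j|e /cs].
  rewrite horner_sum mxE; apply: eq_bigr => i _.
  by rewrite hornerZ c0 mulrC.
move=> [s [t [s' [t' [a [b [d0 ce]]]]]]].
exists t, (s + t0 * t), t', (s' + t0 * t'), a, b; split.
  have -> : t * (s' + t0 * t') - t' * (s + t0 * t) = - (s * t' - s' * t) by ring.
  by rewrite oppr_eq0.
rewrite -!nu_moebius !scalemxAl -mulmxDl -ce; apply/rowP => j; rewrite !mxE horner_sum.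
by apply: eq_bigr => i _; rewrite hornerZ !mxE mulrC.
Qed.

(** (x^i - u^i) / (x - u) written without division, so that u = x is allowed; the ring is general
    because u may be a polynomial. *)
Fixpoint divdiff (R : comNzRingType) (x u : R) i : R :=
  if i is i'.+1 then x ^+ i' + u * divdiff x u i' else 0.

Lemma divdiffE (R : comNzRingType) (x u : R) i : (x - u) * divdiff x u i = x ^+ i - u
  ^+ i.
Proof.
elim: i => [|i IHi] /=; first by rewrite mulr0 subrr.
by rewrite mulrDr mulrCA IHi !exprS; ring.
Qed.

Lemma horner_divdiff x (u : {poly K}) i e :
  (divdiff x%:P u i).[e] = divdiff x u.[e] i.
Proof.
elim: i => [|i IHi] /=; first exact: horner0.
by rewrite hornerD hornerM IHi -polyC_exp hornerC.
Qed.

(* A sequence killed by c T^2 + b T + a is a combination of x^i and of the divided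
   difference (x^i - y^i) / (x - y) for its roots x and y; a double root is separated
   by moving y. *)
Lemma recurrence_secant_limit n (q : 'rV[K]_n.+1) (p : nat -> K) :
  (2 <= n)%N -> (forall i : 'I_n.+1, q 0 i = p i) -> ~ secant_limit q -> no_quadratic n
    p.
Proof.
move=> n2 qp nsec a b c rec; apply: NNPP => nabc; apply: nsec.
have [c0|c0] := eqVneq c 0; last first.
  (* Two finite roots x and y of c T^2 + b T + a. *)
  have [x /= xE] := solve_monicpoly (fun i => if i == 0%N then - a / c else - b / c)
    (isT : (0 < 2)%N).
  rewrite !big_ord_recl big_ord0 /= addr0 expr0 expr1 mulr1 in xE.
  pose y := - b / c - x; pose be := p 1%N - x * p 0%N.
  have bE : b = - c * (x + y) by rewrite /y; field.
  have aE : a = c * x * y.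
    have -> : c * x * y = - b * x - c * x ^+ 2 by rewrite /y; field.
    by rewrite xE; field.
  have pE i : (i.+1 <= n)%N -> p i = p 0%N * x ^+ i + be * divdiff x y i /\
      p i.+1 = p 0%N * x ^+ i.+1 + be * divdiff x y i.+1.
    elim: i => [|i IHi] hi; first by rewrite /be /=; split; ring.
    have [e1 e2] := IHi (ltnW hi); split=> //.
    have := rec i hi; rewrite aE bE => e.
    have -> : p i.+2 = (x + y) * p i.+1 - x * y * p i.
      apply/eqP; rewrite -subr_eq0; apply/eqP; apply: (mulfI c0);
        rewrite mulr0 -[RHS]e; ring.
    by rewrite e2 e1 /= !exprS; ring.
  (* The second root moves with the parameter only when it equals the first. *)
  pose Y : {poly K} := y%:P + (x == y)%:R *: 'X.
  exists (fun i => (p 0%N * x ^+ i)%:P + be *: divdiff x%:P Y i); split=> [i|e e0].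
    rewrite hornerD hornerC hornerZ horner_divdiff hornerD hornerC hornerZ hornerX
      mulr0 addr0 qp.
    case: (ltnP i n) => [/pE []//|ni].
    have iE : (i : nat) = n.-1.+1 by have := ltn_ord i; lia.
    by rewrite iE; have [|_ h] := pE n.-1; [lia | rewrite h].
  pose u := Y.[e].
  have xu : x - u != 0.
    rewrite /u hornerD hornerC hornerZ hornerX; have [xy|xy] := eqVneq x y.
      by rewrite {1}xy mul1r opprD addrA subrr sub0r oppr_eq0.
    by rewrite mul0r addr0 subr_eq0.
  exists 1, x, 1, u, (p 0%N + be / (x - u)), (- be / (x - u)); split.
    by rewrite !mul1r -opprB oppr_eq0.
  apply/rowP => i; rewrite !mxE !expr1n !mul1r hornerD hornerC hornerZ horner_divdiff
    -/u.
  have -> : divdiff x u i = (x ^+ i - u ^+ i) / (x - u).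
    by rewrite -divdiffE mulrC mulKf.
  by field.
(* One root is finite and the other infinite: p is geometric except in its last entry, so q lies on
   the secant through [nu n 1 x] and [nu n 0 1]. *)
have [b0|b0] := eqVneq b 0; last first.
  pose x := - a / b.
  have pE i : (i < n)%N -> p i = p 0%N * x ^+ i.
    elim: i => [|i IHi] hi; first by rewrite mulr1.
    have := rec i hi; rewrite c0 mul0r addr0 IHi ?(ltnW hi) // => e.
    apply: (mulfI b0); apply/eqP; rewrite -subr_eq0; apply/eqP;
      rewrite -[RHS]e /x exprS; field.
    exact: b0.
  exists (fun i => (q 0 i)%:P); split=> [i|e e0]; first by rewrite hornerC.
  exists 1, x, 0, 1, (p 0%N), (p n - p 0%N * x ^+ n); split;
    first by rewrite mulr1 mul0r subr0 oner_neq0.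
  apply/rowP => i; rewrite mxE hornerC qp [RHS]mxE [in X in _ + X]mxE nu_01 2!mxE
    expr1n mul1r.
  case: (eqVneq (i : nat) n) => [->|ni]; first by rewrite mulr1; ring.
  by rewrite mulr0 addr0 pE // ltn_neqAle ni -ltnS ltn_ord.
(* A double root at infinity: only the last two entries of p can be nonzero, and q is a limit of
   points on the secants through [nu n 0 1] and [nu n e 1]. *)
have a0 : a != 0 by apply/eqP => a0; apply: nabc.
have p0 i : (i.+2 <= n)%N -> p i = 0.
  by move=> /rec; rewrite b0 c0 !mul0r !addr0 => /eqP;
    rewrite mulf_eq0 (negPf a0) => /eqP.
exists (fun i : 'I_n.+1 => if (i : nat) == n then (p n)%:P else p n.-1 *: 'X^(n.-1 -
  i)); split=> [i|e e0].
  rewrite qp; case: (eqVneq (i : nat) n) => [->|ni]; first exact: hornerC.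
  rewrite hornerZ hornerXn; have [->|ni'] := eqVneq (i : nat) n.-1;
    first by rewrite subnn mulr1.
  have hi : (i < n.-1)%N.
    by rewrite ltn_neqAle ni' -ltnS prednK ?(ltnW n2) // ltn_neqAle ni -ltnS ltn_ord.
  rewrite (p0 i); last by move: hi; move: (nat_of_ord i) => k; clear; lia.
  by rewrite expr0n subn_eq0 leqNgt hi mulr0.
exists 0, 1, e, 1, (p n - p n.-1 / e), (p n.-1 / e); split;
  first by rewrite mul0r mulr1 sub0r oppr_eq0.
apply/rowP => i; rewrite mxE [RHS]mxE [in X in X + _]mxE nu_01 2!mxE expr1n mulr1.
case: (eqVneq (i : nat) n) => [->|ni]; first by rewrite hornerC subnn mulr1 expr0; ring.
rewrite hornerZ hornerXn mulr0 add0r.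
have -> : (n - i = (n.-1 - i).+1)%N.
  have : (i < n)%N by rewrite ltn_neqAle ni -ltnS ltn_ord.
  by move: (nat_of_ord i) => k; clear; lia.
by rewrite exprS; field.
Qed.

End RationalNormalCurve.

(** * From the projected curve to a parametrization by polynomials *)

Theorem theorem1p3 (K : closedFieldType) (charK0 : [pchar K] =i pred0)
    (r : nat) (hr : (4 <= r)%N)
    (p : 'rV[K]_r.+2) (hp : has_rank (@rnc K r.+1) p 3)
    (M : 'M[K]_(r.+2, r.+1)) (hM : projection_from p M)
    (L : 'M[K]_(2, r.+1))
    (hL : trisecant_line (proj_image M (@rnc K r.+1)) L) :
  let C := proj_image M (@rnc K r.+1) in
  let CL := pts_inter C (pts_line L) in
  let IX := hideal (pts_union C (pts_line L)) in
  (exists k : nat, is_rank_index IX k /\ (k <= 4)%N) /\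
  ((at_most_two_points CL <->
      exists q : 'rV[K]_r.+1, CL q /\ mult_ge (inter_ideal C L) q 2) /\
   (at_most_two_points CL -> is_rank_index IX 4)).
Proof.
have K2 : (2%:R : K) != 0.
  by have := charK0 2; rewrite !inE /= => ->.
case: r hr p hp M hM L hL => [|[|r]] // hr p [_ [p0 _] pmin] M [fullM /andP [kMp pkM]]
  L hL C.
set n := r.+3 in p p0 pmin M fullM kMp pkM L hL C *.
have pM : p *m M = 0 by apply/sub_kermxP.
(* Such a limit lies in the second self-join, against rank 3. *)
have nlim : ~ secant_limit p.
  by move=> /(secant_limit_join (isT : (0 < n)%N) p0) /(pmin 2 isT).
have [freeL _] := hL.
have [c cL c0] : exists2 c : 'rV_n, (c <= kermx L^T)%MS & c != 0.
  apply/rowV0Pn; rewrite kermx_eq0 /row_free mxrank_tr neq_ltn.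
  by rewrite (leq_ltn_trans (rank_leq_row _)).
have freeMT : row_free M^T by rewrite /row_free mxrank_tr.
have w0 : rVpoly (c *m M^T) != 0.
  apply: contraNneq c0 => e; apply/eqP/(row_free_inj freeMT).
  by rewrite mul0mx -[LHS]rVpolyK e linear0.
(* The pullback of [c] is nonzero at [1 : t0]. Once this parameter is at infinity, that pullback has
   full degree n, so C and L do not meet at the infinite point. *)
have [t0] := closed_nonrootP _ w0; rewrite rootE => wt0.
pose S := moebius n t0; have uS : S \in unitmx := moebius_unit n t0.
pose A := (S *m M)^T; pose p' := p *m invmx S.
have p'0 : p' != 0.
  by apply: contraNneq p0 => e; rewrite -[p](mulmxKV uS) -/p' e mul0mx.
have p'A : p' *m A^T = 0 by rewrite /A trmxK mulmxA mulmxKV.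
pose pp i := p' 0 (inord i).
have ppE (i : 'I_n.+1) : p' 0 i = pp i by rewrite /pp inord_val.
have nq : no_quadratic n pp.
  apply: (@recurrence_secant_limit K n p' pp isT ppE) => /(secant_limit_moebius t0).
  by rewrite /p' mulmxKV.
have rM : \rank M = n by apply/eqP.
have freeA : row_free A.
  rewrite /row_free /A mxrank_tr eqn_leq rank_leq_col -{1}rM.
  by rewrite -{1}[M](mulKmx uS) mxrankM_maxr.
have pair_mx (f : {poly K}) : pairing n pp f = (poly_rV f *m p'^T) 0 0.
  by rewrite mxE; apply: eq_bigr => i _; rewrite [poly_rV f _ _]mxE [p'^T _ _]mxE ppE.
have AE : (A :=: kermx p'^T)%MS.
  apply/eqmxP; have sA : (A <= kermx p'^T)%MS.
    by apply/sub_kermxP; rewrite -[A]trmxK -trmx_mul p'A trmx0.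
  rewrite -(geq_leqif (mxrank_leqif_eq sA)) mxrank_ker mxrank_tr (eqP freeA).
  by rewrite (rank_rV p') p'0 subn1.
have pairA (f : {poly K}) : (size f <= n.+1)%N -> pairing n pp f = 0 <-> (poly_rV f <=
  A)%MS.
  move=> _; rewrite AE pair_mx; split=> [e|/sub_kermxP ->]; last by rewrite mxE.
  by apply/sub_kermxP/matrixP => i j; rewrite !ord1 e mxE.
have parE (y : 'rV_n.+1) j : (y *m (row j A)^T) 0 0 = (y *m (S *m M)) 0 j.
  by rewrite mxE [RHS]mxE; apply: eq_bigr => k _; congr (_ * _); rewrite /A 3!mxE.
have vptE t : vpt (par A) t = rnc_vec n t (1 + t0 * t) *m M.
  by rewrite -nu_moebius -mulmxA; apply/rowP => j; rewrite mxE /par -nu_poly parE.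
have vinfE : vinf (par A) = rnc_vec n 1 t0 *m M.
  have -> : rnc_vec n 1 t0 = rnc_vec n 0 1 *m S by rewrite nu_moebius mulr1 add0r.
  by rewrite -mulmxA; apply/rowP => j; rewrite mxE /par -nu_coef parE.
have size_c : size (\sum_j c 0 j *: par A j) = n.+1.
  rewrite sum_par; apply/eqP; rewrite eqn_leq size_poly ltnNge; apply/negP => sc.
  case/negP: wt0; apply/eqP; rewrite -nu_poly trmx_mul trmxK.
  have -> : rnc_vec n 1 t0 = rnc_vec n 0 1 *m S by rewrite nu_moebius mulr1 add0r.
  rewrite mulmxA -(mulmxA _ S) -mulmxA -[S *m M]trmxK -/A -trmx_mul nu_coef.
  exact: nth_default.
have m2 : (2 <= r)%N by [].
apply: (@param_theorem K K2 n r erefl m2 A pp freeA nq pairA C L c hL) => //.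
- exact/sub_kermxP.
- move=> t vt0; split=> //; exists (rnc_vec n t (1 + t0 * t)); split; last exact: vptE.
  apply: rnc_nu; have [->|//] := eqVneq t 0.
  by rewrite mulr0 addr0 oner_neq0 orbT.
move=> x [x0 [y [[s [t [st /andP [/sub_rVP [a yE] _]]]] xE]]]; split=> //.
(* In the new parameter (s, t) becomes (t - t0 s, s), which is infinite exactly when t = t0 s. *)
have nuE : rnc_vec n s t = rnc_vec n (t - t0 * s) s *m S by rewrite nu_moebius subrK.
rewrite xE yE nuE; have [s0|s0] := eqVneq (t - t0 * s) 0.
  exists (a * s ^+ n); right; rewrite vinfE s0 nu_0 -!scalemxAl scalerA; congr (_ *: _).
  by rewrite nu_moebius mulr1 add0r.
exists (a * (t - t0 * s) ^+ n); left; exists (s / (t - t0 * s)).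
by rewrite vptE nu_scale // -!scalemxAl scalerA nu_moebius.
Qed.
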